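(* Let $\mathfrak F$ be the class of finite groups. Then $\mathbf H^{\mathfrak F}\mathfrak F$ is closed under countable directed unions, amalgamated products and HNN-extensions.
   Context: For the class $\mathfrak F$ of finite groups, $\mathbf H^{\mathfrak F}\mathfrak F$ is the smallest class of groups containing $\mathfrak F$ with the property that if a group $G$ acts cellularly on a finite dimensional CW-complex $X$ with all isotropy subgroups in $\mathbf H^{\mathfrak F}\mathfrak F$ and such that for each finite subgroup $F\le G$ the fixed point set $X^F$ is contractible, then $G$ is in $\mathbf H^{\mathfrak F}\mathfrak F$. It is assumed that the stabilizer of any cell fixes that cell pointwise. Closure under amalgamated products means $A*_CB$ is in the class whenever $A$ and $B$ are; closure under HNN-extensions means that an HNN-extension $K*_\alpha$ is in the class whenever its base group $K$ is. *)

(* Defs.v *)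
From HB Require Import structures.
From mathcomp Require Import all_boot all_order all_algebra.
From mathcomp Require Import all_classical all_reals all_analysis.

Set Implicit Arguments.
Unset Strict Implicit.
Unset Printing Implicit Defensive.

Import Order.TTheory GRing.Theory Num.Theory numFieldNormedType.Exports.

Local Open Scope classical_set_scope.
Local Open Scope group_scope.

Record subgroup (G : groupType) := Subgroup {
  subgroup_set :> set G;
  subgroup_closed : group_closed [in subgroup_set] }.

Definition subgroup_type (G : groupType) (H : subgroup G) : Type :=
  {x : G | x \in subgroup_set H}.

HB.instance Definition _ (G : groupType) (H : subgroup G) :=
  SubChoice.on (subgroup_type H).
HB.instance Definition _ (G : groupType) (H : subgroup G) :=
  SubChoice_isSubGroup.Build G _ (subgroup_type H) (subgroup_closed H).

Record group_action (G : groupType) (X : Type) := GroupAction {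
  act :> G -> X -> X;
  act1 : forall x, act 1 x = x;
  actM : forall g h x, act (g * h) x = act g (act h x) }.

Section Action.
Variables (G : groupType) (X : Type) (a : group_action G X).

Lemma stabilizer_closed (x : X) : group_closed [in [set g : G | a g x = x]].
Proof.
split=> [|g h]; rewrite !inE /=; first exact: act1.
by move=> gx hx; rewrite -{1}hx -actM -mulgA mulVg mulg1.
Qed.

Definition stabilizer (x : X) : subgroup G := Subgroup (stabilizer_closed x).

Definition fixed_points (F : set G) : set X :=
  [set x | forall g, F g -> a g x = x].

End Action.

Section CW.
Local Open Scope ring_scope.
Variable R : realType.

Definition disc (n : nat) : set 'rV[R]_n :=
  [set v | \sum_(i < n) v ord0 i ^+ 2 <= 1].
Definition open_disc (n : nat) : set 'rV[R]_n :=
  [set v | \sum_(i < n) v ord0 i ^+ 2 < 1].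
Definition sphere (n : nat) : set 'rV[R]_n :=
  [set v | \sum_(i < n) v ord0 i ^+ 2 = 1].

Arguments disc n : clear implicits.
Arguments open_disc n : clear implicits.
Arguments sphere n : clear implicits.

(* Only the values of [char_map c] on the closed disc are relevant. *)
Record cell_family (X : Type) := CellFamily {
  cell : Type;
  cell_dim : cell -> nat;
  char_map : forall c : cell, 'rV[R]_(cell_dim c) -> X }.

Definition open_cell (X : Type) (E : cell_family X) (c : cell E) : set X :=
  char_map (c := c) @` open_disc (cell_dim c).

Record is_CW_complex (X : topologicalType) (E : cell_family X) : Prop := {
  CW_hausdorff : hausdorff_space X;
  CW_partition : forall x : X, exists! c : cell E, open_cell c x;
  CW_continuous : forall c : cell E,
    {within disc (cell_dim c), continuous (char_map (c := c))};
  CW_homeo : forall c : cell E, exists2 f : X -> 'rV[R]_(cell_dim c),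
    forall v, open_disc (cell_dim c) v -> f (char_map v) = v &
    {within open_cell c, continuous f};
  CW_closure_finite : forall c : cell E, exists2 S : set (cell E),
    finite_set S /\ (forall d, S d -> (cell_dim d < cell_dim c)%N) &
    char_map (c := c) @` sphere (cell_dim c) `<=` \bigcup_(d in S) open_cell d;
  CW_weak_topology : forall A : set X,
    (forall c : cell E, closed (A `&` closure (open_cell c))) -> closed A }.

Definition finite_dimensional (X : Type) (E : cell_family X) : Prop :=
  exists N : nat, forall c : cell E, (cell_dim c <= N)%N.

(* The last clause is the convention that the (setwise) stabilizer of a cell
   fixes the cell pointwise. *)
Record cellular_action (X : topologicalType) (E : cell_family X)
    (G : groupType) (a : group_action G X) : Prop := {
  cellular_continuous : forall g, continuous (a g);
  cellular_cell : forall g (c : cell E), exists2 d : cell E,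
    cell_dim d = cell_dim c & a g @` open_cell c = open_cell d;
  cellular_rigid : forall g (c : cell E), a g @` open_cell c = open_cell c ->
    forall x, open_cell c x -> a g x = x }.

(* In particular a contractible subspace is nonempty. *)
Definition contractible (X : topologicalType) (A : set X) : Prop :=
  exists (x0 : X) (h : R * X -> X),
    [/\ A x0,
        {within `[0, 1] `*` A, continuous h},
        forall t x, t \in `[0, 1] -> A x -> A (h (t, x)),
        forall x, A x -> h (0, x) = x &
        forall x, A x -> h (1, x) = x0].

(* The class H^F F, where F is the class of finite groups. *)
Inductive HFF : groupType -> Prop :=
| HFF_finite (G : groupType) : finite_set [set: G] -> HFF G
| HFF_action (G : groupType) (X : topologicalType) (E : cell_family X)
    (a : group_action G X) :
    is_CW_complex E -> finite_dimensional E -> cellular_action E a ->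
    (forall x : X, HFF (subgroup_type (stabilizer a x))) ->
    (forall F : subgroup G, finite_set F -> contractible (fixed_points a F)) ->
    HFF G.

End CW.

Definition closed_under_countable_directed_unions (C : groupType -> Prop) :=
  forall (G : groupType) (I : Type) (H : I -> subgroup G),
    countable [set: I] ->
    (forall i j, exists k, H i `<=` H k /\ H j `<=` H k) ->
    \bigcup_i (H i : set G) = [set: G] ->
    (forall i, C (subgroup_type (H i))) -> C G.

(* G, with i : A -> G and j : B -> G, is the amalgamated product A *_C B along
   the monomorphisms f : C -> A and g : C -> B, i.e. the pushout of f and g. *)
Record is_amalgamated_product (A B C G : groupType)
    (f : {multiplicative C -> A}) (g : {multiplicative C -> B})
    (i : {multiplicative A -> G}) (j : {multiplicative B -> G}) : Prop := {
  amalgam_injl : injective f;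
  amalgam_injr : injective g;
  amalgam_comm : forall c, i (f c) = j (g c);
  amalgam_univ : forall (L : groupType)
    (p : {multiplicative A -> L}) (q : {multiplicative B -> L}),
    (forall c, p (f c) = q (g c)) ->
    exists u : {multiplicative G -> L},
      [/\ forall x, u (i x) = p x, forall y, u (j y) = q y &
        forall v : {multiplicative G -> L},
          (forall x, v (i x) = p x) -> (forall y, v (j y) = q y) -> v =1 u] }.

Definition closed_under_amalgamated_products (P : groupType -> Prop) :=
  forall (A B C G : groupType)
    (f : {multiplicative C -> A}) (g : {multiplicative C -> B})
    (i : {multiplicative A -> G}) (j : {multiplicative B -> G}),
    is_amalgamated_product f g i j -> P A -> P B -> P G.

(* G, with k : K -> G and t in G, is the HNN-extension of K with stable letter t
   along the monomorphism alpha : A -> K, i.e. the group generated by K and t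
   subject to the relations t^-1 * x * t = alpha x for x in A. *)
Record is_HNN_extension (K : groupType) (A : subgroup K)
    (alpha : {multiplicative subgroup_type A -> K})
    (G : groupType) (k : {multiplicative K -> G}) (t : G) : Prop := {
  HNN_inj : injective alpha;
  HNN_rel : forall x : subgroup_type A, k (val x) ^ t = k (alpha x);
  HNN_univ : forall (L : groupType) (p : {multiplicative K -> L}) (s : L),
    (forall x : subgroup_type A, p (val x) ^ s = p (alpha x)) ->
    exists u : {multiplicative G -> L},
      [/\ forall x, u (k x) = p x, u t = s &
        forall v : {multiplicative G -> L},
          (forall x, v (k x) = p x) -> v t = s -> v =1 u] }.

Definition closed_under_HNN_extensions (P : groupType -> Prop) :=
  forall (K : groupType) (A : subgroup K)
    (alpha : {multiplicative subgroup_type A -> K})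
    (G : groupType) (k : {multiplicative K -> G}) (t : G),
    is_HNN_extension alpha k t -> P K -> P G.

(* Main.v *)
From HB Require Import structures.
Require Import Defs.
From mathcomp Require Import all_boot all_order all_algebra.
From mathcomp Require Import all_classical all_reals all_analysis.
From mathcomp Require Import zify ring lra.

(** A group that acts on a tree without inversions, with all vertex stabilizers in
   the class, is in the class (lemma [tree_HFF]); each closure property is an
   instance of this, for a tree of cosets in the manner of Bass and Serre.

   The geometric realization of a tree is a one-dimensional CW-complex.  A finite
   group of automorphisms fixes a vertex [o], the center of an orbit
   ([finite_subgroup_fix]).  Sliding each point along its geodesic to [o], at
   constant speed, contracts the realization to [o]; as geodesics are unique, this
   homotopy commutes with every automorphism that fixes [o], so that it contracts
   the fixed point set of the finite group as well
   ([fixed_points_contractible]).  Edge stabilizers are subgroups of vertex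
   stabilizers, and the class is closed under subgroups because an action can be
   restricted ([HFF_inj]).

   That a connected graph is a tree is expressed by its edges being bridges.  For
   a graph of cosets it is enough to find a potential on the vertices, with values
   in the functions from the edges to the booleans, that changes along each edge
   by the indicator function of this edge ([coset_tree_HFF]).  For an increasing
   union of subgroups the potential is explicit.  For an amalgamated product or an
   HNN-extension [G], with set of edges [E], it is a cocycle of [G] with values in
   the functions on [E].  A cocycle is a homomorphism to a semidirect product, so
   it comes from the universal property.  The universal property also yields that
   the graph is connected, since [G] is generated by its base groups (and the
   stable letter), and that the base groups embed in [G], by an explicit action
   on a product of two groups ([amalgam_injective], [HNN_injective]); hence the
   vertex stabilizers are isomorphic to the base groups. *)

Set Implicit Arguments.
Unset Strict Implicit.
Unset Printing Implicit Defensive.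

Import Order.TTheory GRing.Theory Num.Theory numFieldNormedType.Exports.

Local Open Scope classical_set_scope.
Local Open Scope group_scope.

(** * Group homomorphisms, subgroups and restriction of actions *)

Lemma mult1 (G H : groupType) (f : {multiplicative G -> H}) : f 1 = 1.
Proof. by apply: (mulgI (f 1)); rewrite -gmulfM !mulg1. Qed.

Lemma multV (G H : groupType) (f : {multiplicative G -> H}) x :
  f x^-1 = (f x)^-1.
Proof. by apply: (mulgI (f x)); rewrite -gmulfM !mulgV mult1. Qed.

Lemma subgroup1 (G : groupType) (H : subgroup G) : subgroup_set H 1.
Proof. by have [+ _] := subgroup_closed H; rewrite inE. Qed.

Lemma subgroupV (G : groupType) (H : subgroup G) x :
  subgroup_set H x -> subgroup_set H x^-1.
Proof.
by have := group_closedV (subgroup_closed H) => + Hx => /(_ x); rewrite !inE; apply.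
Qed.

Lemma subgroupM (G : groupType) (H : subgroup G) x y :
  subgroup_set H x -> subgroup_set H y -> subgroup_set H (x * y).
Proof.
move=> Hx Hy; have := group_closedM (subgroup_closed H) => /(_ x y).
by rewrite !inE; apply.
Qed.

(** The closure condition for a set given by a proposition. *)
Lemma set_group_closed (G : groupType) (S : set G) :
  S 1 -> (forall x y, S x -> S y -> S (x^-1 * y)) -> group_closed [in S].
Proof.
move=> S1 SM; have SV x : S x -> S x^-1 by move=> /SM /(_ S1); rewrite mulg1.
split=> [|x y]; rewrite !inE // => /SV Sx /SV Sy.
by move: (SM _ _ Sx Sy); rewrite invgK.
Qed.

Lemma image_subgroup_closed (G H : groupType) (f : {multiplicative G -> H})
    (S : subgroup G) : group_closed [in f @` S].
Proof.
apply: set_group_closed => [|_ _ [x Sx <-] [y Sy <-]].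
  by exists 1; [exact: subgroup1 | exact: mult1].
exists (x^-1 * y); last by rewrite gmulfM multV.
by apply: subgroupM => //; apply: subgroupV.
Qed.

Definition image_subgroup (G H : groupType) (f : {multiplicative G -> H})
  (S : subgroup G) : subgroup H := Subgroup (image_subgroup_closed f S).

Lemma full_closed (G : groupType) : group_closed [in [set: G]].
Proof. exact: set_group_closed. Qed.

Definition full_subgroup (G : groupType) : subgroup G := Subgroup (@full_closed G).

Section CorestrictedHom.
Variables (G H : groupType) (S : subgroup H) (f : {multiplicative G -> H}).
Hypothesis fS : forall x, subgroup_set S (f x).

Definition corestrict (x : G) : subgroup_type S := exist _ (f x) (mem_set (fS x)).

Fact corestrict_mult : {morph corestrict : x y / x * y}.
Proof. by move=> x y; apply: val_inj; rewrite valM /= gmulfM. Qed.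

HB.instance Definition _ := isMultiplicative.Build _ _ corestrict corestrict_mult.
End CorestrictedHom.

(** A map with a proof that it is multiplicative, as a homomorphism. *)
Definition mkhom (G H : groupType) (f : G -> H)
  (fM : {morph f : x y / x * y}) : G -> H := f.

HB.instance Definition _ (G H : groupType) (f : G -> H) (fM : {morph f : x y / x * y}) :=
  isMultiplicative.Build G H (mkhom fM) fM.

(** The action of [G'] obtained from an action of [G] along [f : G' -> G]. *)
Definition restrict_action (G G' : groupType) (f : {multiplicative G' -> G})
    (X : Type) (a : group_action G X) : group_action G' X.
Proof.
exists (fun g => a (f g)) => [x|g h x]; first by rewrite mult1 act1.
by rewrite gmulfM actM.
Defined.

(** The class is closed under isomorphisms and subgroups: a group that embeds in
   [G] acts on the same complexes, with smaller stabilizers. *)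
Lemma HFF_inj (R : realType) (G : groupType) : HFF R G ->
  forall (G' : groupType) (f : {multiplicative G' -> G}), injective f -> HFF R G'.
Proof.
elim=> {G} [G finG|G X E a cwE dimE cellE _ IH ctr] G' f injf.
  apply: HFF_finite; rewrite -(@preimage_setT G' G f).
  by apply: finite_preimage => // x y _ _ /injf.
apply: (@HFF_action R G' X E (restrict_action f a)) => //.
- have [cont cellc rig] := cellE.
  by split=> [g|g c|g c]; [exact: cont | exact: cellc | exact: rig].
- move=> x; have fs (g : subgroup_type (stabilizer (restrict_action f a) x)) :
    subgroup_set (stabilizer a x) ((f \o val) g) by case: g => g /= /set_mem.
  apply: (IH x _ (corestrict fs)) => -[g gx] [h hx] /(congr1 val) /= /injf gh.
  by apply: val_inj.
- move=> F finF.
  have -> : fixed_points (restrict_action f a) F = fixed_points a (image_subgroup f F).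
    apply/seteqP; split=> [x fx _ [g Fg <-]|x fx g Fg]; first exact: fx.
    by apply: fx; exists g.
  by apply: ctr; exact: finite_image.
Qed.

(** The image of an embedding of [G] is in the class if [G] is. *)
Lemma HFF_image (R : realType) (G H : groupType) (f : {multiplicative G -> H}) :
  injective f -> HFF R G -> HFF R (subgroup_type (image_subgroup f (full_subgroup G))).
Proof.
move=> injf HG; pose S := image_subgroup f (full_subgroup G).
have /choice [r rE] (y : subgroup_type S) : exists x, f x = val y.
  by have [x _ xy] := set_mem (valP y); exists x.
have rM : {morph r : x y / x * y}.
  by move=> x y; apply: injf; rewrite gmulfM !rE valM.
apply: (HFF_inj HG (f := mkhom rM)) => x y xy.
by apply: val_inj; have := congr1 f xy; rewrite /mkhom !rE.
Qed.

(** * Trees *)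

(** The edge [e] has endpoints [v] and [w], in either direction. *)
Definition joins (V E : Type) (src tgt : E -> V) (e : E) (v w : V) : Prop :=
  (src e = v /\ tgt e = w) \/ (src e = w /\ tgt e = v).

(** There is a walk of length [n] from [v] to [w]. *)
Fixpoint walk (V E : Type) (src tgt : E -> V) (n : nat) (v w : V) : Prop :=
  if n is m.+1 then exists e u, joins src tgt e v u /\ walk src tgt m u w
  else v = w.

Section Walks.
Variables (V E : Type) (src tgt : E -> V).
Implicit Types (v w x : V) (e : E).
Local Notation joins := (joins src tgt).
Local Notation walk := (walk src tgt).

Lemma joins_sym e v w : joins e v w -> joins e w v.
Proof. by case; [right | left]. Qed.

Lemma walk1 e v w : joins e v w -> walk 1 v w.
Proof. by move=> evw; exists e, w. Qed.

Lemma walk_cat m n v x w : walk m v x -> walk n x w -> walk (m + n) v w.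
Proof.
elim: m v => [|m IH] v /=; first by move=> ->.
by move=> [e [u [evu /IH uw]]] /uw uw'; exists e, u.
Qed.

Lemma walk_sym n v w : walk n v w -> walk n w v.
Proof.
elim: n v => [|n IH] v /=; first by [].
move=> [e [u [evu /IH wu]]].
by have := walk_cat wu (walk1 (joins_sym evu)); rewrite addn1.
Qed.

End Walks.

(** A tree is encoded as a connected graph in which every edge [e] is a bridge:
   [side e] is a partition of the vertices into two sides which separates the
   endpoints of [e] and of no other edge.  Edges are oriented. *)
Record tree := Tree {
  vertex : Type;
  edge : Type;
  src : edge -> vertex;
  tgt : edge -> vertex;
  side : edge -> vertex -> bool;
  side_src : forall e, side e (src e) = false;
  side_tgt : forall e, side e (tgt e) = true;
  side_other : forall e e', e <> e' -> side e (src e') = side e (tgt e');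
  connected : forall v w, exists n, walk src tgt n v w }.

Section Tree.
Variable T : tree.
Implicit Types (v w x y o : vertex T) (e : edge T).

Local Notation joins := (joins (@src T) (@tgt T)).
Local Notation walk := (walk (@src T) (@tgt T)).

Lemma joins_src_tgt e : joins e (src e) (tgt e). Proof. by left. Qed.

Lemma joins_side e v w : joins e v w -> side e w = ~~ side e v.
Proof. by case=> -[<- <-]; rewrite side_src side_tgt. Qed.

Lemma joins_side_other e e' v w : joins e' v w -> e <> e' -> side e v = side e w.
Proof. by case=> -[<- <-] /side_other ->. Qed.

Lemma joins_endpoint e v w x y :
  joins e v w -> joins e x y -> side e v = side e x -> v = x /\ w = y.
Proof. by case=> -[<- <-] [] [<- <-]; rewrite ?side_src ?side_tgt. Qed.

Lemma walkP v w : exists n, `[<walk n v w>].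
Proof. by have [n nP] := connected v w; exists n; exact/asboolP. Qed.

(** The combinatorial distance: the length of a shortest walk. *)
Definition dist v w := ex_minn (walkP v w).

Lemma walk_dist v w : walk (dist v w) v w.
Proof. by rewrite /dist; case: ex_minnP => n /asboolP. Qed.

Lemma dist_le n v w : walk n v w -> dist v w <= n.
Proof. by move=> nP; rewrite /dist; case: ex_minnP => m _; apply; exact/asboolP. Qed.

Lemma distC v w : dist v w = dist w v.
Proof. by apply/eqP; rewrite eqn_leq !dist_le //; exact/walk_sym/walk_dist. Qed.

Lemma distxx v : dist v v = 0.
Proof. by apply/eqP; rewrite -leqn0; exact: dist_le. Qed.

Lemma dist_eq0 v w : dist v w = 0 -> v = w.
Proof. by move=> d0; have := walk_dist v w; rewrite d0. Qed.

Lemma dist_triangle x v w : dist v w <= dist v x + dist x w.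
Proof. exact: dist_le (walk_cat (walk_dist v x) (walk_dist x w)). Qed.

Lemma dist_joins e v w : joins e v w -> dist v w <= 1.
Proof. by move=> vw; exact: dist_le (walk1 vw). Qed.

(** A walk from one side of [e] to the other is split at its first passage through
   [e]. *)
Lemma walk_cross e n x y : walk n x y -> side e x != side e y ->
  exists v w p q, [/\ joins e v w, side e v = side e x,
    walk p x v, walk q w y & n = p.+1 + q].
Proof.
elim: n x => [|n IH] x /=; first by move=> ->; rewrite eqxx.
move=> [e' [u [xu uy]]] exy.
have [ee'|ee'] := pselect (e = e').
  by exists x, u, 0, n; rewrite ee'.
have xuE := joins_side_other xu ee'; rewrite xuE in exy.
have [v [w [p [q [vw vu pP qP ->]]]]] := IH u uy exy.
by exists v, w, p.+1, q; split=> //; [rewrite vu | exists e', u].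
Qed.

(** A path from one side of an edge to the other runs through that edge. *)
Lemma dist_cross e v w x y : joins e v w -> side e x = side e v ->
  side e y = side e w -> dist x y = dist x v + 1 + dist w y.
Proof.
move=> vw xv yw; apply/eqP; rewrite eqn_leq; apply/andP; split.
  rewrite -addnA; apply: leq_trans (dist_triangle v _ _) _; rewrite leq_add2l.
  by apply: leq_trans (dist_triangle w _ _) _; rewrite leq_add2r (dist_joins vw).
have [|v' [w' [p [q [vw' v'x pP qP ->]]]]] := walk_cross (walk_dist x y) (e := e).
  by rewrite xv yw (joins_side vw); case: (side e v).
have [<- <-] := joins_endpoint vw' vw (etrans v'x xv).
by move: (dist_le pP) (dist_le qP); lia.
Qed.

Lemma dist_edge e v w y : joins e v w -> side e y = side e v ->
  dist w y = (dist v y).+1.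
Proof.
move=> vw yv; rewrite distC (dist_cross vw yv erefl) distxx addn0 addn1.
by rewrite distC.
Qed.

Lemma dist_edge_neq e v w y : joins e v w -> dist v y <> dist w y.
Proof.
move=> vw; have := joins_side vw; case: (eqVneq (side e y) (side e v)).
  by move=> yv _; rewrite (dist_edge vw yv); lia.
move=> yv wv; have yw : side e y = side e w by move: yv; rewrite wv; do 2 case: side.
by rewrite (dist_edge (joins_sym vw) yw); lia.
Qed.

Lemma side_dist e v w y : joins e v w -> dist w y < dist v y ->
  side e y = side e w.
Proof.
move=> vw lt; case: (eqVneq (side e y) (side e v)) => [yv|].
  by move: lt; rewrite (dist_edge vw yv); lia.
by rewrite (joins_side vw); do 2 case: side.
Qed.

Lemma dist_closer e v w y : joins e v w -> dist w y < dist v y ->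
  dist v y = (dist w y).+1.
Proof. by move=> vw /(side_dist vw) yw; exact: dist_edge (joins_sym vw) yw. Qed.

Lemma closer_exists v o : v <> o -> exists e w, joins e v w /\ dist w o < dist v o.
Proof.
have := walk_dist v o; case: (dist v o) => [|n] //=.
move=> [e [u [vu uo]]] _; exists e, u; split=> //.
by rewrite ltnS dist_le.
Qed.

Lemma closer_uniq v o e w e' w' : joins e v w -> dist w o < dist v o ->
  joins e' v w' -> dist w' o < dist v o -> e = e' /\ w = w'.
Proof.
move=> vw dw vw' dw'.
have ee' : e = e'.
  apply: contrapT => ee'.
  have wv : side e' w = side e' v by rewrite (joins_side_other vw (nesym ee')).
  have := dist_cross vw' wv (side_dist vw' dw').
  have := dist_closer vw dw; have := dist_closer vw' dw'; lia.
split=> //; move: vw'; rewrite -ee' => vw'.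
by have [] := joins_endpoint vw vw' erefl.
Qed.

(** The edge at [v] pointing to [o], with its other endpoint. *)
Definition toward o v : option (edge T * vertex T) :=
  if pselect (v = o) is right vo then
    let e := cid (closer_exists vo) in Some (projT1 e, projT1 (cid (projT2 e)))
  else None.

Lemma toward_root o : toward o o = None.
Proof. by rewrite /toward; case: pselect. Qed.

Lemma towardE o v e w : joins e v w -> dist w o < dist v o ->
  toward o v = Some (e, w).
Proof.
move=> vw dw; rewrite /toward; case: pselect => [vo|vo].
  by move: dw; rewrite vo distxx ltn0.
case: cid => e' /= ex; case: cid => w' /= [vw' dw'].
by have [-> ->] := closer_uniq vw' dw' vw dw.
Qed.

Lemma toward_spec o v n : dist v o = n.+1 ->
  exists e w, [/\ toward o v = Some (e, w), joins e v w & dist w o = n].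
Proof.
move=> dv; have vo : v <> o by move=> vo; move: dv; rewrite vo distxx.
have [e [w [vw dw]]] := closer_exists vo; exists e, w; split=> //.
  exact: towardE.
by move: (dist_closer vw dw); rewrite dv => -[].
Qed.

End Tree.

(** * Groups acting on trees *)

(** The action preserves the orientation of the edges, so that no edge is
   inverted. *)
Record tree_action (T : tree) (G : groupType) := TreeAction {
  vact : group_action G (vertex T);
  eact : group_action G (edge T);
  src_eact : forall g e, src (eact g e) = vact g (src e);
  tgt_eact : forall g e, tgt (eact g e) = vact g (tgt e) }.

Section TreeAction.
Variables (T : tree) (G : groupType) (a : tree_action T G).
Implicit Types (v w x y o : vertex T) (e : edge T) (g : G).

Local Notation joins := (joins (@src T) (@tgt T)).
Local Notation walk := (walk (@src T) (@tgt T)).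

Lemma actK (X : Type) (b : group_action G X) g : cancel (b g) (b g^-1).
Proof. by move=> x; rewrite -actM mulVg act1. Qed.

Lemma actVK (X : Type) (b : group_action G X) g : cancel (b g^-1) (b g).
Proof. by move=> x; rewrite -actM mulgV act1. Qed.

Lemma joins_act g e v w : joins e v w -> joins (eact a g e) (vact a g v) (vact a g w).
Proof. by case=> -[<- <-]; [left | right]; rewrite src_eact tgt_eact. Qed.

Lemma walk_act g n v w : walk n v w -> walk n (vact a g v) (vact a g w).
Proof.
elim: n v => [|n IH] v /=; first by move=> ->.
move=> [e [u [vu /IH uw]]]; exists (eact a g e), (vact a g u); split=> //.
exact: joins_act.
Qed.

Lemma dist_act g v w : dist (vact a g v) (vact a g w) = dist v w.
Proof.
apply/eqP; rewrite eqn_leq !dist_le //; last exact/walk_act/walk_dist.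
by rewrite -{2}(actK (vact a) g v) -{2}(actK (vact a) g w); exact/walk_act/walk_dist.
Qed.

Lemma toward_act g o v e w : vact a g o = o -> toward o v = Some (e, w) ->
  toward o (vact a g v) = Some (eact a g e, vact a g w).
Proof.
move=> go; have [->|vo] := pselect (v = o); first by rewrite toward_root.
have [e' [w' [vw' dw']]] := closer_exists vo.
rewrite (towardE vw' dw') => -[<- <-]; apply: towardE; first exact: joins_act.
by rewrite -go !dist_act.
Qed.

(** A finite group [F] of automorphisms of a tree fixes a vertex: the closed
   balls of minimal radius that contain an [F]-orbit have their centers within
   distance one of each other, and no edge is inverted. *)
Lemma finite_subgroup_fix (F : subgroup G) o : finite_set F ->
  exists v, forall g, subgroup_set F g -> vact a g v = v.
Proof.
move=> finF.
pose ball n v := forall g, subgroup_set F g -> dist v (vact a g o) <= n.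
have exball : exists n, `[<exists v, ball n v>].
  have /finite_seqP [s Fs] := finF.
  exists (\max_(g <- s) dist o (vact a g o)); apply/asboolP; exists o => g Fg.
  have gs : g \in s by move: Fg; rewrite Fs.
  exact: leq_bigmax_seq.
case: (ex_minnP exball) => n /asboolP [v vn] minn.
have ball_act f w : subgroup_set F f -> ball n w -> ball n (vact a f w).
  move=> Ff wn g Fg; rewrite -(dist_act f^-1) actK -actM; apply: wn.
  by apply: subgroupM => //; apply: subgroupV.
(* two centers are at distance at most one: otherwise a vertex in between is the
   center of a smaller ball *)
have near v' w : ball n v' -> ball n w -> dist v' w <= 1.
  move=> v'n wn; rewrite leqNgt; apply/negP => d1.
  have v'w : v' <> w by move=> v'w; move: d1; rewrite v'w distxx.
  have [e [x [ex dx]]] := closer_exists v'w.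
  have dE := dist_closer ex dx; have xw := side_dist ex dx.
  have xn : forall g, subgroup_set F g -> dist x (vact a g o) < n.
    move=> g Fg; have := v'n g Fg; have := wn g Fg; set y := vact a g o => wy v'y.
    case: (eqVneq (side e y) (side e v')) => [yv|yv].
      have := dist_cross ex yv xw; rewrite (distC y w) (distC y v') (distC x w) in dE *.
      by have := dist_edge ex yv; lia.
    have yx : side e y = side e x.
      by move: yv; rewrite (joins_side ex); do 2 case: side.
    by have := dist_edge (joins_sym ex) yx; lia.
  have n0 : 0 < n by apply: leq_ltn_trans (xn 1 (subgroup1 F)).
  have : n <= n.-1.
    apply: minn; apply/asboolP; exists x => g Fg.
    by have := xn g Fg; lia.
  by lia.
exists v => f Ff; apply: contrapT => fv.
have fvn := ball_act f v Ff vn.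
have ffvn := ball_act f _ Ff fvn.
have [e [w [ew dw]]] := closer_exists (nesym fv).
have dvfv : dist v (vact a f v) <= 1 by exact: near.
have wE : w = vact a f v by apply: dist_eq0; lia.
subst w; have few := joins_act f ew.
have [efe|efe] := pselect (e = eact a f e).
  (* [f] preserves [e] together with its orientation *)
  case: ew => -[sv tv]; [rewrite -sv in fv | rewrite -tv in fv].
    by apply: fv; rewrite -src_eact -efe.
  by apply: fv; rewrite -tgt_eact -efe.
(* the vertices [v], [f v] and [f (f v)] would form a triangle, unless [f]
   exchanges the endpoints of an edge *)
have dd : dist (vact a f v) v = dist (vact a f (vact a f v)) v \/
    vact a f (vact a f v) = v.
  have [->|ffv] := pselect (vact a f (vact a f v) = v); [by right | left].
  have d1 : dist v (vact a f (vact a f v)) <= 1 by exact: near.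
  have d0 : dist v (vact a f (vact a f v)) <> 0 by move=> /dist_eq0 /esym.
  have d0' : dist v (vact a f v) <> 0 by move=> /dist_eq0 /esym.
  by rewrite distC (distC _ v); lia.
case: dd => [|ffv]; first exact: (dist_edge_neq few).
by move: (joins_side_other few efe); rewrite ffv (joins_side ew); case: side.
Qed.

End TreeAction.

(** * The geometric realization of a tree *)

(** The points of the realization: the vertices, and a copy of the open interval
   from [-1] to [1] for each edge. *)
Inductive realization (R : realType) (T : tree) : Type :=
| Vertex of vertex T
| Inner (e : edge T) (t : R) of (-1 < t < 1)%R.
Arguments Vertex {R T}.

HB.instance Definition _ (R : realType) (T : tree) :=
  gen_eqMixin (realization R T).
HB.instance Definition _ (R : realType) (T : tree) :=
  gen_choiceMixin (realization R T).

Section Realization.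
Local Open Scope ring_scope.
Variables (R : realType) (T : tree).
Implicit Types (e : edge T) (v w o : vertex T) (t s : R) (x y : realization R T).

Local Notation X := (realization R T).

(** The parametrization of the closed edge [e] by the interval from [-1] to [1],
   extended to the real line by constants. *)
Definition chart e t : X :=
  match @idP (-1 < t < 1) with
  | ReflectT t1 => Inner e t1
  | ReflectF _ => Vertex (if t <= 0 then src e else tgt e)
  end.

Lemma chart_inner e t (t1 : -1 < t < 1) : chart e t = Inner e t1.
Proof.
rewrite /chart; case: {-}_ / idP => [t1'|//].
by congr Inner; exact: bool_irrelevance.
Qed.

Lemma chart_src e t : t <= -1 -> chart e t = Vertex (src e).
Proof.
move=> t1; rewrite /chart; case: {-}_ / idP => [t1'|_]; first by exfalso; lra.
by rewrite ifT //; lra.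
Qed.

Lemma chart_tgt e t : 1 <= t -> chart e t = Vertex (tgt e).
Proof.
move=> t1; rewrite /chart; case: {-}_ / idP => [t1'|_]; first by exfalso; lra.
by rewrite ifF //; lra.
Qed.

Variant chart_spec e t : X -> Prop :=
| ChartSrc of t <= -1 : chart_spec e t (Vertex (src e))
| ChartTgt of 1 <= t : chart_spec e t (Vertex (tgt e))
| ChartInner (t1 : -1 < t < 1) : chart_spec e t (Inner e t1).

Lemma chartP e t : chart_spec e t (chart e t).
Proof.
case: (boolP (-1 < t < 1)) => [t1|]; first by rewrite (chart_inner e t1); constructor.
rewrite negb_and -!leNgt => /orP [] t1.
  by rewrite chart_src //; constructor.
by rewrite chart_tgt //; constructor.
Qed.

(** The final topology of the charts, which is the weak topology of the
   CW-complex. *)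
Definition real_open : set_system X := [set A | forall e, open (chart e @^-1` A)].

Fact real_openT : real_open setT.
Proof. by move=> e; rewrite preimage_setT; exact: openT. Qed.

Fact real_openI : setI_closed real_open.
Proof. by move=> A B oA oB e; rewrite preimage_setI; apply: openI. Qed.

Fact real_open_bigU (I : Type) (f : I -> set X) :
  (forall i, real_open (f i)) -> real_open (\bigcup_i f i).
Proof.
by move=> of_ e; rewrite preimage_bigcup; apply: bigcup_open => i _; exact: of_.
Qed.
End Realization.

HB.instance Definition _ (R : realType) (T : tree) :=
  isOpenTopological.Build (realization R T)
    (@real_openT R T) (@real_openI R T) (@real_open_bigU R T).

Section RealizationTopology.
Local Open Scope ring_scope.
Variables (R : realType) (T : tree).
Implicit Types (e : edge T) (v w o : vertex T) (t s : R) (x y : realization R T).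

Local Notation X := (realization R T).

Lemma openX (A : set X) : open A <-> forall e, open (chart e @^-1` A).
Proof. by []. Qed.

Lemma closedX (A : set X) : closed A <-> forall e, closed (chart e @^-1` A).
Proof.
split=> [cA e|cA].
  have /openX/(_ e) : open (~` A) by rewrite openC.
  by rewrite -preimage_setC openC.
by rewrite -openC; apply/openX => e; rewrite -preimage_setC openC.
Qed.

Lemma chart_continuous e : continuous (@chart R T e).
Proof. by apply/continuousP => A /openX. Qed.

Lemma continuousX (Y : topologicalType) (f : X -> Y) :
  (forall e, continuous (f \o chart e)) -> continuous f.
Proof.
move=> cf; apply/continuousP => A oA; apply/openX => e.
by have /continuousP := cf e; apply.
Qed.

(** Since the line is locally compact, the product with the line of the final
   topology of the charts is the final topology of the products of the charts. *)
Lemma continuous_prodX (Y : topologicalType) (h : R * X -> Y) :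
  (forall e, continuous (fun p : R * R => h (p.1, chart e p.2))) ->
  (forall x, continuous (fun t => h (t, x))) -> continuous h.
Proof.
move=> ch ch1; apply/continuousP => U oU; rewrite openE => -[t0 x0] /= Ut0.
have /nbhs_closedballP [d dU] : nbhs t0 [set t | U (h (t, x0))].
  by apply: ch1; apply: open_nbhs_nbhs; split.
set K : set R := closed_ball t0 d%:num in dU.
have cK : compact K by exact: closed_ballR_compact.
pose N : set X := [set x | K `<=` [set t | U (h (t, x))]].
have oN : open N.
  apply/openX => e; rewrite openE => s0 Ns0; rewrite /interior.
  have := (compact_near_coveringP K).1 cK R (nbhs s0)
    (fun s t => U (h (t, chart e s))); apply => t Kt.
  have : nbhs (t, s0) [set p : R * R | U (h (p.1, chart e p.2))].
    by apply: (ch e (t, s0)); apply: open_nbhs_nbhs; split=> //; exact: Ns0.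
  by [].
exists (K, N); last by move=> [t x] /= [Kt Nx]; exact: Nx.
split=> /=; first by exists d%:num => /=; [| exact: subset_closed_ball].
exact: open_nbhs_nbhs.
Qed.

(** The retraction of the realization onto the closed edge [e], which sends the
   rest of the tree to the endpoints of [e]. *)
Definition retract e x : R :=
  match x with
  | Vertex v => if side e v then 1 else -1
  | Inner e' t _ => if `[< e = e' >] then t else
                    if side e (src e') then 1 else -1
  end.

(** The retraction of the line onto the interval from [-1] to [1]. *)
Definition clamp t : R := Num.max (-1) (Num.min 1 t).

Lemma clamp_le t : t <= -1 -> clamp t = -1.
Proof. by move=> t1; rewrite /clamp min_r ?max_l //; lra. Qed.

Lemma clamp_ge t : 1 <= t -> clamp t = 1.
Proof. by move=> t1; rewrite /clamp min_l ?max_r //; lra. Qed.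

Lemma clamp_id t : -1 < t < 1 -> clamp t = t.
Proof. by move=> t1; rewrite /clamp min_r ?max_r //; lra. Qed.

Lemma clamp_bounds t : -1 <= clamp t <= 1.
Proof. by rewrite /clamp le_max lexx /= ge_max ge_min lexx /= andbT; lra. Qed.

Lemma clamp_continuous : continuous clamp.
Proof.
move=> t; have := @continuous_max R R (fun=> -1) (fun t => Num.min 1 t) t.
apply; first exact: cst_continuous.
have := @continuous_min R R (fun=> 1) id t.
by apply; [exact: cst_continuous | move=> ?; exact].
Qed.

Lemma retract_chart e t : retract e (chart e t) = clamp t.
Proof.
case: chartP => t1 /=; rewrite ?side_src ?side_tgt.
- by rewrite clamp_le.
- by rewrite clamp_ge.
- by rewrite asboolT // clamp_id.
Qed.

Lemma retract_chart_other e e' t : e <> e' ->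
  retract e (chart e' t) = if side e (src e') then 1 else -1.
Proof.
move=> ee'; case: chartP => //= t1; first by rewrite (side_other ee').
by rewrite asboolF.
Qed.

Lemma retract_continuous e : continuous (retract e).
Proof.
apply: continuousX => e'; have [<-|ee'] := pselect (e = e').
  rewrite (_ : _ \o _ = clamp); first exact: clamp_continuous.
  by apply/funext => t; exact: retract_chart.
rewrite (_ : _ \o _ = fun=> if side e (src e') then 1 else -1).
  exact: cst_continuous.
by apply/funext => t; exact: retract_chart_other.
Qed.

(** The retractions onto the closed edges separate points. *)
Lemma retract_inj x y : (forall e, retract e x = retract e y) -> x = y.
Proof.
have vi v e t (t1 : -1 < t < 1) : retract e (Vertex v) <> retract e (Inner e t1).
  by rewrite /= asboolT //; case: ifP => _ tE; move: t1; rewrite -tE; lra.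
case: x y => [v|e t t1] [w|e' t' t1'] xy.
- congr Vertex; apply: contrapT => vw.
  have [e [u [vu du]]] := closer_exists vw.
  have wu := side_dist vu du.
  have := xy e; rewrite /= wu (joins_side vu); case: side => /=; lra.
- by case: (vi v e' t' t1').
- by case: (vi w e t t1).
have [ee'|ee'] := pselect (e = e').
  move: (xy e) => {xy}; subst e'; rewrite /= !asboolT // => tt'; subst t'.
  by congr Inner; exact: bool_irrelevance.
have := xy e; rewrite /= asboolT // asboolF //.
by case: ifP => _ tE; exfalso; lra.
Qed.

Lemma realization_hausdorff : hausdorff_space X.
Proof.
move=> x y xy; apply: retract_inj => e; apply: (@Rhausdorff R) => A B Ax By.
have [z [Az Bz]] := xy _ _ (retract_continuous Ax) (retract_continuous By).
by exists (retract e z); split.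
Qed.

End RealizationTopology.

Section CWStructure.
Local Open Scope ring_scope.
Variables (R : realType) (T : tree).
Implicit Types (e : edge T) (v w o : vertex T) (t s : R) (x y : realization R T).

Local Notation X := (realization R T).

(** The zero-cells are the vertices, the one-cells are the edges. *)
Definition tree_cell : Type := (vertex T + edge T)%type.

Definition tree_cell_dim (c : tree_cell) : nat := if c is inr _ then 1 else 0.

Definition tree_char_map (c : tree_cell) : 'rV[R]_(tree_cell_dim c) -> X :=
  match c with
  | inl v => fun=> Vertex v
  | inr e => fun u => chart e (u ord0 ord0)
  end.

Definition tree_cells : cell_family R X := CellFamily tree_char_map.

Lemma open_cell_vertex v x :
  open_cell (E := tree_cells) (inl v : tree_cell) x <-> x = Vertex v.
Proof.
split=> [[u _ <-] //|->]; exists 0 => //.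
by rewrite /open_disc /= big_ord0.
Qed.

Lemma open_cell_edge e x :
  open_cell (E := tree_cells) (inr e : tree_cell) x <->
  exists t (t1 : -1 < t < 1), x = Inner e t1.
Proof.
split=> [[u] |[t [t1 ->]]]; rewrite /open_disc /=.
  rewrite big_ord1 => u1 <-.
  have t1 : -1 < u ord0 ord0 < 1 by nra.
  by exists (u ord0 ord0), t1; exact: chart_inner.
exists (const_mx t); last by rewrite /= mxE (chart_inner e t1).
by rewrite /open_disc /= big_ord1 mxE; nra.
Qed.

Lemma clamp_chart e t : chart e (clamp t) = chart e t :> X.
Proof.
case: (chartP e t) => t1.
- by rewrite chart_src // clamp_le.
- by rewrite chart_tgt // clamp_ge.
- by rewrite clamp_id // (chart_inner e t1).
Qed.

Lemma closure_edge e t :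
  closure (open_cell (E := tree_cells) (inr e : tree_cell)) (chart e t).
Proof.
rewrite -clamp_chart; have := clamp_bounds t; move: (clamp t) => c c1.
move=> B /chart_continuous /nbhs_ballP [d /= d0 dB].
(* the point [c * (1 - k)] of the open interval is at distance at most [k] of [c] *)
pose k := Num.min d 1 / 2.
have k0 : 0 < k by rewrite divr_gt0 // lt_min d0 ltr01.
have kd : k < d.
  rewrite ltr_pdivrMr //; apply: le_lt_trans (_ : d < d * 2);
    [by rewrite ge_min lexx | lra].
have k1 : k < 1.
  rewrite ltr_pdivrMr //; apply: le_lt_trans (_ : 1 < 1 * 2);
    [by rewrite ge_min lexx orbT | lra].
have ck : -1 < c * (1 - k) < 1 by nra.
exists (chart e (c * (1 - k))); split.
  by apply/open_cell_edge; exists (c * (1 - k)), ck; exact: chart_inner.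
apply: dB; rewrite /ball /= (_ : _ - _ = c * k); last by ring.
by rewrite ltr_norml; nra.
Qed.

Lemma tree_cells_CW : is_CW_complex tree_cells.
Proof.
split.
- exact: realization_hausdorff.
- case=> [v|e t t1].
    exists (inl v); split; first exact/open_cell_vertex.
    case=> [w /open_cell_vertex [->] //|e /open_cell_edge [t [t1]] //].
  exists (inr e); split; first by apply/open_cell_edge; exists t, t1.
  by case=> [w /open_cell_vertex //|e' /open_cell_edge [t' [t1' []]] -> //].
- case=> [v|e] /=; apply: continuous_subspaceT; first exact: cst_continuous.
  move=> u; apply: (@continuous_comp _ _ _
      (fun u : 'rV[R]_1 => u ord0 ord0) (@chart R T e)).
    exact: coord_continuous.
  exact: chart_continuous.
- case=> [v|e] /=.
    exists (fun=> 0); first by move=> u _; apply/rowP; case.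
    by apply: continuous_subspaceT; exact: cst_continuous.
  exists (fun x => const_mx (retract e x)).
    move=> u; rewrite /open_disc /= big_ord1 => u1; apply/rowP => i.
    rewrite mxE retract_chart (_ : i = ord0); last exact: ord1.
    have t1 : -1 < u ord0 ord0 < 1 by nra.
    exact: clamp_id.
  apply: continuous_subspaceT => x A [P Px PA].
  have Pe : nbhs (retract e x) (P ord0 ord0) by have := Px ord0 ord0; rewrite mxE.
  have : nbhs x (retract e @^-1` P ord0 ord0) by exact: retract_continuous.
  apply: filterS => y Py; apply: PA => i j.
  by rewrite !ord1 mxE.
- case=> [v|e] /=.
    exists set0 => [|x [u]]; first by split.
    by rewrite /sphere /= big_ord0 => /eqP; rewrite eq_sym oner_eq0.
  exists [set (inl (src e) : tree_cell); inl (tgt e)].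
    by split=> [|d [] ->]; first exact: finite_set2.
  move=> x [u]; rewrite /sphere /= big_ord1 => /eqP.
  rewrite sqrf_eq1 => /orP [] /eqP -> <-.
    exists (inl (tgt e)); [by right | apply/open_cell_vertex].
    by rewrite chart_tgt.
  exists (inl (src e)); [by left | apply/open_cell_vertex].
  by rewrite chart_src.
- move=> A cA; apply/closedX => e; have /closedX/(_ e) := cA (inr e).
  congr closed; apply/seteqP; split=> t; first by case.
  by move=> At; split=> //; exact: closure_edge.
Qed.

Lemma tree_cells_dim : finite_dimensional tree_cells.
Proof. by exists 1%N; case. Qed.

End CWStructure.

(** * Contraction of a tree to a vertex *)

Section Contraction.
Local Open Scope ring_scope.
Variables (R : realType) (T : tree) (o : vertex T).
Implicit Types (e : edge T) (v w : vertex T) (t s r : R) (x y : realization R T).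

Local Notation X := (realization R T).
Local Notation joins := (joins (@src T) (@tgt T)).

(** The sign that directs the chart of the edge [e] towards its endpoint [v]. *)
Definition orient e v : R := if side e v then 1 else -1.

Lemma chart_orient_far e v w s : joins e v w -> 1 <= s ->
  chart e (orient e v * s) = Vertex v.
Proof.
case=> -[]; [move=> <- _ s1 | move=> _ <- s1]; rewrite /orient ?side_src ?side_tgt.
  by rewrite chart_src //; lra.
by rewrite chart_tgt //; lra.
Qed.

Lemma chart_orient_near e v w s : joins e v w -> s <= -1 ->
  chart e (orient e v * s) = Vertex w.
Proof.
case=> -[<- <-] s1; rewrite /orient ?side_src ?side_tgt.
  by rewrite chart_tgt //; lra.
by rewrite chart_src //; lra.
Qed.

(** For [n = dist v o], the path that stays at [o] until time [0], runs along the
   geodesic to [v], which has length [2 * n], and stays at [v] from then on. *)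
Fixpoint ray n v r : X :=
  if n is m.+1 then
    if toward o v is Some (e, w) then
      if r <= m.*2%:R then ray m w r else chart e (orient e v * (r - m.*2.+1%:R))
    else Vertex v
  else Vertex v.

Lemma ray_end n v r : dist v o = n -> n.*2%:R <= r -> ray n v r = Vertex v.
Proof.
case: n => [|n] //= dv nr; have [e [w [-> vw _]]] := toward_spec dv.
move: nr; rewrite doubleS !mulrSr => nr; rewrite ifF; last by lra.
by apply: chart_orient_far vw _; lra.
Qed.

Lemma ray_root n v r : dist v o = n -> r <= 0 -> ray n v r = Vertex o.
Proof.
elim: n v => [|n IH] v /= dv r0; first by rewrite (dist_eq0 dv).
have [e [w [-> vw dw]]] := toward_spec dv.
by rewrite (le_trans r0) // IH.
Qed.

Lemma glue_continuous (Y : topologicalType) (f g : R -> Y) (c : R) :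
  continuous f -> continuous g -> f c = g c ->
  continuous (fun r => if r <= c then f r else g r).
Proof.
move=> cf cg fg r A; case: (ltgtP r c) => [rc|rc|->] nA.
- have nr : nbhs r [set s | s < c] by exact: lt_nbhsl.
  have nf : nbhs r (f @^-1` A) by exact: cf.
  by apply: filterS2 nr nf => s /= sc As; rewrite /preimage /= (ltW sc).
- have nr : nbhs r [set s | c < s] by exact: lt_nbhsr.
  have ng : nbhs r (g @^-1` A) by exact: cg.
  by apply: filterS2 nr ng => s /= sc As; rewrite /preimage /= leNgt sc.
- have nf : nbhs c (f @^-1` A) by exact: cf.
  have ng : nbhs c (g @^-1` A) by apply: cg; rewrite -fg.
  by apply: filterS2 nf ng => s As Bs; rewrite /preimage /=; case: ifP.
Qed.

Lemma ray_continuous n v : dist v o = n -> continuous (ray n v).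
Proof.
elim: n v => [|n IH] v dv; first exact: cst_continuous.
have [e [w [vE vw dw]]] := toward_spec dv; rewrite /= vE.
apply: (@glue_continuous _ (ray n w) (fun r => chart e (orient e v * (r - n.*2.+1%:R)))).
- exact: IH.
- move=> r; apply: (@continuous_comp _ _ _ (fun r => orient e v * (r - n.*2.+1%:R))).
    apply: cvgM; first exact: cvg_cst.
    by apply: cvgB; [exact: cvg_id | exact: cvg_cst].
  exact: chart_continuous.
rewrite ray_end // (chart_orient_near vw) //.
by rewrite mulrSr; lra.
Qed.

(** The endpoint of [e] that is farther from the root [o]. *)
Definition far e : vertex T :=
  if (dist (src e) o < dist (tgt e) o)%N then tgt e else src e.

Lemma far_spec e : exists w, joins e (far e) w /\ dist (far e) o = (dist w o).+1.
Proof.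
rewrite /far; have := dist_edge_neq (y := o) (joins_src_tgt e).
case: ltngtP => // d _.
  exists (src e); have te := joins_sym (joins_src_tgt e); split=> //.
  exact: dist_closer te d.
exists (tgt e); have te := joins_src_tgt e; split=> //.
exact: dist_closer te d.
Qed.

(** The point [x] lies on the path [ray] to [apex x], at time [height x]. *)
Definition apex x : vertex T :=
  match x with Vertex v => v | Inner e _ _ => far e end.

Definition height x : R :=
  match x with
  | Vertex v => (dist v o).*2%:R
  | Inner e s _ => (dist (far e) o).*2%:R - 1 + orient e (far e) * s
  end.

Definition ray_to x : R -> X := ray (dist (apex x) o) (apex x).

(** The homotopy that moves every point along its geodesic to [o], at constant
   speed. *)
Definition contract_to (p : R * X) : X :=
  ray_to p.2 ((1 - Num.max p.1 0) * height p.2).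

Lemma ray_to_height x : ray_to x (height x) = x.
Proof.
case: x => [v|e s s1]; rewrite /ray_to /=; first exact: ray_end.
have [w [ew dE]] := far_spec e; rewrite dE /=.
rewrite (towardE ew); last by rewrite dE.
have os : -1 < orient e (far e) * s < 1 by rewrite /orient; case: ifP => _; lra.
rewrite ifF; last by rewrite doubleS !mulrSr; lra.
rewrite (_ : orient _ _ * _ = s) ?(chart_inner e s1) //.
by rewrite doubleS !mulrSr /orient; case: ifP => _; lra.
Qed.

Lemma contract_to0 x : contract_to (0, x) = x.
Proof. by rewrite /contract_to /= maxxx subr0 mul1r ray_to_height. Qed.

Lemma contract_to1 x : contract_to (1, x) = Vertex o.
Proof. by rewrite /contract_to /= max_l // subrr mul0r; exact: ray_root. Qed.

(** At both ends of the edge [e] the formula agrees with the value of the homotopy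
   at the vertex. *)
Lemma contract_to_chart t e s :
  contract_to (t, chart e s) =
  ray (dist (far e) o) (far e)
    ((1 - Num.max t 0) * ((dist (far e) o).*2%:R - 1 + orient e (far e) * clamp s)).
Proof.
have [w [ew dE]] := far_spec e.
have t0 : 0 <= Num.max t 0 by rewrite le_max lexx orbT.
have contr_far : contract_to (t, Vertex (far e)) =
    ray (dist (far e) o) (far e) ((1 - Num.max t 0) * ((dist (far e) o).*2%:R - 1 + 1)).
  by rewrite /contract_to /ray_to /= subrK.
have contr_near : contract_to (t, Vertex w) =
    ray (dist (far e) o) (far e) ((1 - Num.max t 0) * ((dist (far e) o).*2%:R - 1 + -1)).
  rewrite /contract_to /ray_to /= dE /= (towardE ew) ?dE //.
  rewrite doubleS !mulrSr ifT; last first.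
    by have : 0 <= (dist w o).*2%:R :> R by []; nra.
  by congr ray; lra.
rewrite /orient; case: (chartP e s) => s1; last by rewrite clamp_id.
- rewrite clamp_le //; case: ew contr_near contr_far => -[<- <-] contr_near contr_far.
    by rewrite side_src mulN1r opprK.
  by rewrite side_tgt mul1r.
- rewrite clamp_ge //; case: ew contr_near contr_far => -[<- <-] contr_near contr_far.
    by rewrite side_src mulr1.
  by rewrite side_tgt mul1r.
Qed.

Lemma contract_to_continuous : continuous contract_to.
Proof.
have max0 : continuous (fun t : R => Num.max t 0).
  move=> t; have := @continuous_max R R id (fun=> 0) t.
  by apply; [move=> ?; exact | exact: cst_continuous].
apply: continuous_prodX => [e|x].
  rewrite (_ : (fun _ => _) = ray (dist (far e) o) (far e) \o (fun p : R * R =>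
    (1 - Num.max p.1 0) * ((dist (far e) o).*2%:R - 1 + orient e (far e) * clamp p.2))).
    move=> p; apply: continuous_comp; last exact: ray_continuous.
    apply: cvgM.
      apply: cvgB; first exact: cvg_cst.
      apply: (@continuous_comp _ _ _ fst (fun t : R => Num.max t 0)); last exact: max0.
      exact: cvg_fst.
    apply: cvgD; first exact: cvg_cst.
    apply: cvgM; first exact: cvg_cst.
    apply: (@continuous_comp _ _ _ snd (fun s : R => clamp s)); last first.
      exact: clamp_continuous.
    exact: cvg_snd.
  by apply/funext => -[t s]; rewrite /= contract_to_chart.
move=> t; apply: (@continuous_comp _ _ _
    (fun t => (1 - Num.max t 0) * height x) (ray_to x)); last exact: ray_continuous.
apply: cvgM; last exact: cvg_cst.
by apply: cvgB; [exact: cvg_cst | exact: max0].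
Qed.

End Contraction.

(** * The action on the realization *)

Section RealizationAction.
Local Open Scope ring_scope.
Variables (R : realType) (T : tree) (G : groupType) (a : tree_action T G).
Implicit Types (e : edge T) (v w o : vertex T) (t s r : R) (x y : realization R T).

Local Notation X := (realization R T).
Local Notation joins := (joins (@src T) (@tgt T)).

Definition real_act (g : G) x : X :=
  match x with
  | Vertex v => Vertex (vact a g v)
  | Inner e t t1 => Inner (eact a g e) t1
  end.

Fact real_act1 x : real_act 1%g x = x.
Proof. by case: x => [v|e t t1] /=; rewrite act1. Qed.

Fact real_actM g h x : real_act (g * h)%g x = real_act g (real_act h x).
Proof. by case: x => [v|e t t1] /=; rewrite actM. Qed.

Definition realization_action : group_action G X := GroupAction real_act1 real_actM.

Lemma chart_act g e t : chart (eact a g e) t = real_act g (chart e t).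
Proof.
case: (chartP e t) => t1 /=; last exact: chart_inner.
  by rewrite chart_src // src_eact.
by rewrite chart_tgt // tgt_eact.
Qed.

Lemma realization_cellular : cellular_action (tree_cells R T) realization_action.
Proof.
split=> [g|g c|g c].
- apply: continuousX => e; rewrite (_ : _ \o _ = chart (eact a g e)).
    exact: chart_continuous.
  by apply/funext => t; rewrite chart_act.
- case: c => [v|e].
    exists (inl (vact a g v)) => //.
    apply/seteqP; split=> [_ [x /open_cell_vertex -> <-]|x].
      exact/open_cell_vertex.
    by move=> /open_cell_vertex ->; exists (Vertex v) => //; exact/open_cell_vertex.
  exists (inr (eact a g e)) => //.
  apply/seteqP; split=> [_ [x /open_cell_edge [t [t1 ->]] <-]|x].
    by apply/open_cell_edge; exists t, t1.
  move=> /open_cell_edge [t [t1 ->]]; exists (Inner e t1) => //.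
  by apply/open_cell_edge; exists t, t1.
case: c => [v|e] gc x.
  move=> /open_cell_vertex ->; apply/open_cell_vertex.
  by rewrite -gc; exists (Vertex v) => //; exact/open_cell_vertex.
move=> /open_cell_edge [t [t1 ->]] /=.
have : open_cell (E := tree_cells R T) (inr e : tree_cell T) (Inner (eact a g e) t1).
  by rewrite -gc; exists (Inner e t1) => //; apply/open_cell_edge; exists t, t1.
move=> /open_cell_edge [t' [t1' gtE]].
have -> // : eact a g e = e by case: gtE.
Qed.

Section FixedRoot.
Variables (g : G) (o : vertex T).
Hypothesis go : vact a g o = o.

Lemma dist_act_root v : dist (vact a g v) o = dist v o.
Proof. by rewrite -{1}go dist_act. Qed.

Lemma orient_act e v w : joins e v w ->
  orient R (eact a g e) (vact a g v) = orient R e v.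
Proof.
rewrite /orient; case=> -[]; [move=> <- _ | move=> _ <-].
  by rewrite -src_eact !side_src.
by rewrite -tgt_eact !side_tgt.
Qed.

Lemma ray_act n v r : dist v o = n ->
  ray o n (vact a g v) r = real_act g (ray o n v r).
Proof.
elim: n v => [//|n IH] v dv /=.
have [e [w [vE vw dw]]] := toward_spec dv.
rewrite vE (toward_act go vE); case: ifP => _; first exact: IH.
by rewrite (orient_act vw) chart_act.
Qed.

Lemma far_act e : far o (eact a g e) = vact a g (far o e).
Proof. by rewrite /far src_eact tgt_eact !dist_act_root; case: ifP. Qed.

Lemma contract_to_act t x :
  contract_to o (t, real_act g x) = real_act g (contract_to o (t, x)).
Proof.
rewrite /contract_to /ray_to /=.
have -> : apex o (real_act g x) = vact a g (apex o x).
  by case: x => //= e s _; exact: far_act.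
have -> : height o (real_act g x) = height o x.
  case: x => [v|e s _] /=; rewrite ?far_act dist_act_root //.
  by have [w [ew _]] := far_spec o e; rewrite (orient_act ew).
by rewrite dist_act_root ray_act.
Qed.

End FixedRoot.

Lemma fixed_points_contractible (F : subgroup G) o :
  (forall g, subgroup_set F g -> vact a g o = o) ->
  contractible R (fixed_points realization_action F).
Proof.
move=> Fo; exists (Vertex o), (contract_to o); split.
- by move=> g /Fo /= ->.
- by apply: continuous_subspaceT; exact: contract_to_continuous.
- move=> t x _ Fx g Fg /=; rewrite -contract_to_act; last exact: Fo.
  by congr contract_to; congr pair; exact: Fx.
- by move=> x _; exact: contract_to0.
- by move=> x _; exact: contract_to1.
Qed.

Theorem tree_HFF o :
  (forall v, HFF R (subgroup_type (stabilizer (vact a) v))) -> HFF R G.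
Proof.
move=> HV; apply: (HFF_action (a := realization_action)).
- exact: tree_cells_CW.
- exact: tree_cells_dim.
- exact: realization_cellular.
- move=> x; pose v := if x is Inner e _ _ then src e else
    if x is Vertex v then v else o.
  have sv (g : subgroup_type (stabilizer realization_action x)) :
      subgroup_set (stabilizer (vact a) v) (val g).
    case: g => g /= /set_mem; rewrite {}/v; case: x => [v|e t t1] /= [] //.
    by move=> ge; rewrite -src_eact ge.
  apply: (HFF_inj (HV v) (f := corestrict sv)) => -[g gx] [h hx] /(congr1 val) /= gh.
  by apply: val_inj.
- move=> F finF; have [v Fv] := finite_subgroup_fix a o finF.
  exact: fixed_points_contractible Fv.
Qed.

End RealizationAction.

(** * Graphs of cosets *)

(** The disjoint union of the coset spaces [G / K i]. *)
Record coset (G : groupType) (I : Type) (K : I -> subgroup G) := Coset {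
  coset_index : I;
  coset_set : set G;
  cosetP : exists g, coset_set = [set h | subgroup_set (K coset_index) (g^-1 * h)] }.

Section Cosets.
Variables (G : groupType) (I : Type) (K : I -> subgroup G).
Implicit Types (i : I) (g h : G) (c : coset K).

(** The coset [g * K i]. *)
Definition mkcoset i g : coset K :=
  Coset (ex_intro _ g (erefl [set h | subgroup_set (K i) (g^-1 * h)])).

Definition coset_repr c : G := projT1 (cid (cosetP c)).

Lemma coset_eq i (S S' : set G) p p' :
  S = S' -> @Coset G I K i S p = @Coset G I K i S' p'.
Proof. by move=> SS'; subst S'; congr Coset; exact: Prop_irrelevance. Qed.

Lemma mkcoset_repr c : mkcoset (coset_index c) (coset_repr c) = c.
Proof.
case: c => i S p; rewrite /mkcoset /=; apply: coset_eq; rewrite /coset_repr.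
by case: cid => g /= ->.
Qed.

Lemma mkcoset_eq i g h :
  subgroup_set (K i) (g^-1 * h) -> mkcoset i g = mkcoset i h.
Proof.
move=> gh; apply: coset_eq; apply/seteqP; split=> x /= gx.
  have := subgroupM (subgroupV gh) gx.
  by rewrite invgM invgK -mulgA mulVKg.
by have := subgroupM gh gx; rewrite -mulgA mulVKg.
Qed.

Lemma mkcoset_inj i g h :
  mkcoset i g = mkcoset i h -> subgroup_set (K i) (g^-1 * h).
Proof.
move=> [] /seteqP [_ /(_ h)]; apply => /=.
by rewrite mulVg; exact: subgroup1.
Qed.

Lemma mkcoset_mulr i g k : subgroup_set (K i) k -> mkcoset i (g * k) = mkcoset i g.
Proof. by move=> Kk; apply/esym/mkcoset_eq; rewrite mulKg. Qed.

Lemma coset_repr_mk i g :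
  exists k, subgroup_set (K i) k /\ coset_repr (mkcoset i g) = g * k.
Proof.
have /= /esym/mkcoset_inj Kk := mkcoset_repr (mkcoset i g).
by exists (g^-1 * coset_repr (mkcoset i g)); rewrite mulVKg.
Qed.

Definition coset_act g c : coset K := mkcoset (coset_index c) (g * coset_repr c).

Lemma coset_act_mk g i h : coset_act g (mkcoset i h) = mkcoset i (g * h).
Proof.
rewrite /coset_act /=; have [k [Kk ->]] := coset_repr_mk i h.
by rewrite mulgA (mkcoset_mulr _ Kk).
Qed.

Fact coset_act1 c : coset_act 1 c = c.
Proof. by rewrite /coset_act mul1g mkcoset_repr. Qed.

Fact coset_actM g h c : coset_act (g * h) c = coset_act g (coset_act h c).
Proof. by rewrite {1 3}/coset_act coset_act_mk mulgA. Qed.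

Definition coset_action : group_action G (coset K) :=
  GroupAction coset_act1 coset_actM.

Lemma coset_act_base i g c :
  `[< coset_action g^-1 c = mkcoset i 1 >] = `[< c = mkcoset i g >].
Proof.
apply: asbool_equiv_eq; split=> [gc|->]; last by rewrite /= coset_act_mk mulVg.
by rewrite -(actVK coset_action g c) gc /= coset_act_mk mulg1.
Qed.

Lemma coset_ind (P : coset K -> Prop) : (forall i g, P (mkcoset i g)) -> forall c, P c.
Proof. by move=> Pmk c; rewrite -(mkcoset_repr c). Qed.

End Cosets.

(** Conjugation by [g], as a homomorphism. *)
Definition conjhom (G : groupType) (g x : G) : G := x ^ g.

Fact conjhom_mult (G : groupType) (g : G) : {morph conjhom g : x y / x * y}.
Proof. by move=> x y; exact: conjMg. Qed.

HB.instance Definition _ (G : groupType) (g : G) :=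
  isMultiplicative.Build G G (conjhom g) (@conjhom_mult G g).

(** The stabilizer of the coset [g * K i] is a conjugate of [K i]. *)
Lemma HFF_coset_stabilizer (R : realType) (G : groupType) (I : Type)
    (K : I -> subgroup G) (c : coset K) :
  HFF R (subgroup_type (K (coset_index c))) ->
  HFF R (subgroup_type (stabilizer (coset_action K) c)).
Proof.
elim/coset_ind: c => i g /= Ki.
have sv (h : subgroup_type (stabilizer (coset_action K) (mkcoset K i g))) :
    subgroup_set (K i) ((conjhom g \o val) h).
  have /set_mem /= := valP h; rewrite coset_act_mk => hg; have := mkcoset_inj (esym hg).
  by rewrite /= /conjhom conjgE.
apply: (HFF_inj Ki (f := corestrict sv)) => u v uv.
by apply: val_inj; exact: conjg_inj (congr1 val uv).
Qed.

(** The graph with vertices the cosets [g * KV i] and edges the cosets [g * KE j],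
   where [g * KE j] joins [g * KV (s j)] to [g * x j * KV (t j)].  It is a tree
   as soon as it is connected and has a potential: a function [phi] of the
   vertices, with values in the functions from the edges to the booleans, which
   changes along each edge by the indicator function of that edge. *)
Section CosetGraph.
Variables (G : groupType) (I J : Type) (KV : I -> subgroup G) (KE : J -> subgroup G).
Variables (s t : J -> I) (x : J -> G).
Hypothesis KEs : forall j h, subgroup_set (KE j) h -> subgroup_set (KV (s j)) h.
Hypothesis KEt : forall j h, subgroup_set (KE j) h ->
  subgroup_set (KV (t j)) (h ^ x j).

Local Notation vtx := (coset KV).
Local Notation edg := (coset KE).

Definition coset_src (e : edg) : vtx := mkcoset KV (s (coset_index e)) (coset_repr e).
Definition coset_tgt (e : edg) : vtx :=
  mkcoset KV (t (coset_index e)) (coset_repr e * x (coset_index e)).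

Lemma coset_src_mk j g : coset_src (mkcoset KE j g) = mkcoset KV (s j) g.
Proof.
rewrite /coset_src /=; have [k [Kk ->]] := coset_repr_mk KE j g.
by rewrite mkcoset_mulr //; exact: KEs.
Qed.

Lemma coset_tgt_mk j g : coset_tgt (mkcoset KE j g) = mkcoset KV (t j) (g * x j).
Proof.
rewrite /coset_tgt /=; have [k [Kk ->]] := coset_repr_mk KE j g.
rewrite -mulgA (_ : k * x j = x j * k ^ x j); last by rewrite conjgE mulVKg.
by rewrite mulgA (mkcoset_mulr _ (KEt Kk)).
Qed.

(** Two vertices in the same connected component. *)
Definition linked (v w : vtx) : Prop := exists n, walk coset_src coset_tgt n v w.

Lemma linked_refl v : linked v v. Proof. by exists 0. Qed.

Lemma linked_sym v w : linked v w -> linked w v.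
Proof. by move=> [n nP]; exists n; exact: walk_sym. Qed.

Lemma linked_trans v w u : linked v w -> linked w u -> linked v u.
Proof. by move=> [n nP] [m mP]; exists (n + m)%N; exact: walk_cat nP mP. Qed.

Lemma linked_edge j g : linked (mkcoset KV (s j) g) (mkcoset KV (t j) (g * x j)).
Proof.
exists 1%N; apply: (walk1 (e := mkcoset KE j g)).
by left; rewrite coset_src_mk coset_tgt_mk.
Qed.

Lemma coset_src_act g e :
  coset_src (coset_action KE g e) = coset_action KV g (coset_src e).
Proof.
by elim/coset_ind: e => j h; rewrite /= coset_act_mk !coset_src_mk coset_act_mk.
Qed.

Lemma coset_tgt_act g e :
  coset_tgt (coset_action KE g e) = coset_action KV g (coset_tgt e).
Proof.
by elim/coset_ind: e => j h; rewrite /= coset_act_mk !coset_tgt_mk coset_act_mk mulgA.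
Qed.

Lemma linked_act g v w :
  linked v w -> linked (coset_action KV g v) (coset_action KV g w).
Proof.
move=> [n nP]; exists n; elim: n v nP => [|n IH] v; first by move=> /= ->.
move=> [e [u [vu /IH uw]]]; exists (coset_action KE g e), (coset_action KV g u).
by split=> //; case: vu => -[<- <-]; [left | right]; rewrite coset_src_act coset_tgt_act.
Qed.

(** The elements of [G] which move a vertex inside its connected component. *)
Lemma linked_closed i :
  group_closed [in [set g | linked (mkcoset KV i 1) (mkcoset KV i g)]].
Proof.
apply: set_group_closed => [|g h /= lg lh]; first exact: linked_refl.
have := linked_act g^-1 (linked_trans (linked_sym lg) lh).
by rewrite /= !coset_act_mk mulVg.
Qed.

Definition linked_subgroup i : subgroup G := Subgroup (linked_closed i).

Hypothesis graph_connected : forall v w, linked v w.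
Variable phi : I -> G -> edg -> bool.
Hypothesis phi_coset : forall i g k e,
  subgroup_set (KV i) k -> phi i (g * k) e = phi i g e.
Hypothesis phi_edge : forall j g e,
  phi (t j) (g * x j) e = phi (s j) g e (+) `[< e = mkcoset KE j g >].

Definition potential (v : vtx) : edg -> bool := phi (coset_index v) (coset_repr v).

Lemma potential_mk i g e : potential (mkcoset KV i g) e = phi i g e.
Proof.
rewrite /potential /=; have [k [Kk ->]] := coset_repr_mk KV i g.
exact: phi_coset.
Qed.

Lemma potential_edge e e' :
  potential (coset_tgt e') e = potential (coset_src e') e (+) `[< e = e' >].
Proof.
elim/coset_ind: e' => j g.
by rewrite coset_tgt_mk coset_src_mk !potential_mk phi_edge.
Qed.

(** The potential, normalized to vanish at the source of [e]. *)
Definition coset_side e v : bool := potential v e (+) potential (coset_src e) e.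

Fact coset_side_src e : coset_side e (coset_src e) = false.
Proof. exact: addbb. Qed.

Fact coset_side_tgt e : coset_side e (coset_tgt e) = true.
Proof. by rewrite /coset_side potential_edge asboolT // addbT addNb addbb. Qed.

Fact coset_side_other e e' : e <> e' ->
  coset_side e (coset_src e') = coset_side e (coset_tgt e').
Proof. by move=> ee'; rewrite /coset_side potential_edge asboolF // addbF. Qed.

Definition coset_tree : tree :=
  Tree coset_side_src coset_side_tgt coset_side_other graph_connected.

Definition coset_tree_action : tree_action coset_tree G :=
  @TreeAction coset_tree G (coset_action KV) (coset_action KE)
    coset_src_act coset_tgt_act.

Theorem coset_tree_HFF (R : realType) (i : I) :
  (forall i, HFF R (subgroup_type (KV i))) -> HFF R G.
Proof.
move=> HK; apply: (@tree_HFF R coset_tree G coset_tree_action (mkcoset KV i 1)).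
by move=> v; exact: HFF_coset_stabilizer.
Qed.

End CosetGraph.

(** * Countable directed unions *)

(** The tree of an increasing union of subgroups [K n] has the cosets of all the
   [K n] as vertices, and an edge from [g * K n] to [g * K n.+1].  Removal of this
   edge cuts off the cosets contained in [g * K n]. *)
Lemma HFF_increasing_union (R : realType) (G : groupType) (K : nat -> subgroup G) :
  (forall n, K n `<=` K n.+1) -> \bigcup_n (K n : set G) = [set: G] ->
  (forall n, HFF R (subgroup_type (K n))) -> HFF R G.
Proof.
move=> Kinc Kall HK.
have Kle m n : (m <= n)%N -> K m `<=` K n.
  move=> /subnK <-; elim: (n - m)%N => [|d IH] //.
  by apply: subset_trans IH _; exact: Kinc.
have KEt n h : subgroup_set (K n) h -> subgroup_set (K n.+1) (h ^ (fun=> 1) n).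
  by rewrite conjg1; exact: Kinc.
pose phi n g (e : coset K) :=
  (n <= coset_index e)%N && `[< mkcoset K (coset_index e) g = e >].
have KEs n h : subgroup_set (K n) h -> subgroup_set (K (id n)) h by [].
apply: (coset_tree_HFF KEs KEt (phi := phi) _ _ _ 0%N) => //.
- move=> v w; elim/coset_ind: v => m g; elim/coset_ind: w => n h.
  have up k d l : linked K id succn (fun=> 1) (mkcoset K k l) (mkcoset K (d + k) l).
    elim: d => [|d IH]; first exact: linked_refl.
    apply: linked_trans IH _.
    by have := linked_edge KEs KEt (d + k)%N l; rewrite mulg1.
  have [l _ Kl] : (\bigcup_n (K n : set G)) (g^-1 * h) by rewrite Kall.
  apply: linked_trans (up m (n + l)%N g) _; apply: linked_sym.
  apply: linked_trans (up n (m + l)%N h) _.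
  rewrite (_ : n + l + m = m + l + n)%N; last by lia.
  rewrite (mkcoset_eq (g := g) (h := h)); first exact: linked_refl.
  by apply: Kle Kl; lia.
- move=> n g k e Kk; rewrite /phi; case: (leqP n (coset_index e)) => //= ne.
  by rewrite mkcoset_mulr //; exact: Kle Kk.
move=> n g e; rewrite mulg1 /phi.
case: (ltngtP n (coset_index e)) => ne /=.
- by rewrite [X in _ (+) X]asboolF ?addbF // => eE; move: ne; rewrite eE ltnn.
- by rewrite asboolF // => eE; move: ne; rewrite eE ltnn.
rewrite -ne (_ : `[< e = _ >] = `[< mkcoset K n g = e >]) ?addbb //.
by apply: asbool_equiv_eq; split=> /esym.
Qed.

(** A countable directed family, enumerated by [e], has an increasing cofinal
   sequence. *)
Lemma directed_union_chain (G : groupType) (I : Type) (H : I -> subgroup G)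
    (e : nat -> I) :
  (forall i j, exists k, H i `<=` H k /\ H j `<=` H k) ->
  exists c : nat -> I, forall n, H (c n) `<=` H (c n.+1) /\ H (e n) `<=` H (c n).
Proof.
move=> dir; have ub i j := cid (dir i j).
pose c := fix c n := if n is m.+1 then projT1 (ub (c m) (e m.+1)) else e 0.
exists c => n; split; first by rewrite /=; case: (ub _ _) => k [].
by case: n => //= n; case: (ub _ _) => k [].
Qed.

Lemma countable_directed_union_HFF (R : realType) :
  closed_under_countable_directed_unions (HFF R).
Proof.
move=> G I H /countable_injP [f injf] dir HG HH.
have [i0 _ _] : (\bigcup_i (H i : set G)) 1 by rewrite HG.
have /choice [e eP] n : exists i, forall j, f j = n -> i = j.
  have [[i fi]|nf] := pselect (exists i, f i = n).
    by exists i => j fj; apply: injf; rewrite ?inE ?fi ?fj.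
  by exists i0 => j fj; case: nf; exists j.
have eK i : e (f i) = i by exact: eP.
have [c cP] := directed_union_chain e dir.
apply: (@HFF_increasing_union R G (fun n => H (c n))).
- by move=> n; have [] := cP n.
- apply/seteqP; split=> // g _.
  have [i _ ig] : (\bigcup_i (H i : set G)) g by rewrite HG.
  by exists (f i) => //; have [_] := cP (f i); rewrite eK; apply.
- by move=> n; exact: HH.
Qed.

(** * Injectivity of the base groups *)

(** The group of permutations of [S], each given with its inverse. *)
Definition selfbij (S : Type) : Type :=
  {p : (S -> S) * (S -> S) | `[< cancel p.1 p.2 /\ cancel p.2 p.1 >]}.

Section SelfBijections.
Variable S : Type.
Implicit Types p q : selfbij S.

Definition mkbij (f f' : S -> S) (fK : cancel f f') (f'K : cancel f' f) : selfbij S :=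
  exist _ (f, f') (asboolT (conj fK f'K)).

Definition bij_fun p : S -> S := (sval p).1.
Definition bij_inv p : S -> S := (sval p).2.

Lemma bij_funK p : cancel (bij_fun p) (bij_inv p).
Proof. by case: p => /= -[f f'] fP; have [] := asboolW fP. Qed.

Lemma bij_invK p : cancel (bij_inv p) (bij_fun p).
Proof. by case: p => /= -[f f'] fP; have [] := asboolW fP. Qed.

Lemma selfbij_eq p q : bij_fun p =1 bij_fun q -> p = q.
Proof.
move=> pq; have pq' : bij_inv p =1 bij_inv q.
  by move=> x; rewrite -{1}(bij_invK q x) -pq bij_funK.
move: pq pq'; case: p q => [[f f'] fP] [[g g'] gP] /funext fg /funext f'g'.
by apply: eq_exist; rewrite /bij_fun /bij_inv /= in fg f'g' *; rewrite fg f'g'.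
Qed.

Definition bij_one : selfbij S := @mkbij id id (fun=> erefl) (fun=> erefl).
Definition bij_V p := mkbij (@bij_invK p) (@bij_funK p).
Definition bij_mul p q := mkbij (can_comp (@bij_funK p) (@bij_funK q))
  (can_comp (@bij_invK q) (@bij_invK p)).

HB.instance Definition _ := gen_eqMixin (selfbij S).
HB.instance Definition _ := gen_choiceMixin (selfbij S).

Fact bij_mulA : associative bij_mul.
Proof. by move=> p q r; exact: selfbij_eq. Qed.
Fact bij_mul1 : left_id bij_one bij_mul.
Proof. by move=> p; exact: selfbij_eq. Qed.
Fact bij_1mul : right_id bij_one bij_mul.
Proof. by move=> p; exact: selfbij_eq. Qed.
Fact bij_mulV : left_inverse bij_one bij_V bij_mul.
Proof. by move=> p; apply: selfbij_eq => x; exact: bij_funK. Qed.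
Fact bij_Vmul : right_inverse bij_one bij_V bij_mul.
Proof. by move=> p; apply: selfbij_eq => x; exact: bij_invK. Qed.

HB.instance Definition _ :=
  isGroup.Build (selfbij S) bij_mulA bij_mul1 bij_1mul bij_mulV bij_Vmul.

Lemma bij_funM p q x : bij_fun (p * q) x = bij_fun p (bij_fun q x).
Proof. by []. Qed.

End SelfBijections.

(** The permutation representation of an action. *)
Definition action_bij (G : groupType) (S : Type) (b : group_action G S) (g : G) :
  selfbij S := mkbij (actK b g) (actVK b g).

Fact action_bij_mult (G : groupType) (S : Type) (b : group_action G S) :
  {morph action_bij b : g h / g * h}.
Proof. by move=> g h; apply: selfbij_eq => x; exact: actM. Qed.

HB.instance Definition _ (G : groupType) (S : Type) (b : group_action G S) :=
  isMultiplicative.Build G (selfbij S) (action_bij b) (@action_bij_mult G S b).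

(** Left multiplication on the first coordinate. *)
Definition mulact (G : groupType) (S : Type) (g : G) (x : G * S) : G * S :=
  (g * x.1, x.2).

Fact mulact1 (G : groupType) (S : Type) (x : G * S) : mulact 1 x = x.
Proof. by case: x => g s; rewrite /mulact mul1g. Qed.

Fact mulactM (G : groupType) (S : Type) g h (x : G * S) :
  mulact (g * h) x = mulact g (mulact h x).
Proof. by rewrite /mulact mulgA. Qed.

(** The action of [G] on [G * S] by left multiplication. *)
Definition mul_action (G : groupType) (S : Type) : group_action G (G * S) :=
  GroupAction (@mulact1 G S) (@mulactM G S).

(** The action on [S'] transported from [S] along the bijection [f]. *)
Definition conj_fun (G : groupType) (S S' : Type) (b : group_action G S)
  (f : S' -> S) (f' : S -> S') (g : G) (x : S') : S' := f' (b g (f x)).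

Definition transport_action (G : groupType) (S S' : Type) (b : group_action G S)
  (f : S' -> S) (f' : S -> S') (fK : cancel f f') (f'K : cancel f' f) :
  group_action G S'.
Proof.
exists (conj_fun b f f') => [x|g h x]; rewrite /conj_fun ?act1 ?fK //.
by rewrite actM f'K.
Defined.

(** If [C] embeds in [A], each coset of [C] in [A] is a copy of [C]; the choice of
   a base point in each of them gives a [C]-equivariant map from [A] to [C]. *)
Lemma equivariant_retraction (C A : groupType) (f : {multiplicative C -> A}) :
  injective f -> exists r : A -> C, forall c a, r (f c * a) = c * r a.
Proof.
move=> injf; pose S a := [set b | exists c, b = f c * a].
have SE c a : S (f c * a) = S a.
  apply/seteqP; split=> [_ [d ->]|_ [d ->]].
    by exists (d * c); rewrite mulgA gmulfM.
  by exists (d * c^-1); rewrite mulgA gmulfM -mulgA -!mulgA multV mulKg.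
have /choice [r rE] a : exists c, a = f c * xget 1 (S a).
  have : S a (xget 1 (S a)) by apply: xgetPex; exists a, 1; rewrite mult1 mul1g.
  by move=> [c cE]; exists c^-1; rewrite cE multV mulKg.
exists r => c a; apply: injf; apply: (mulIg (xget 1 (S a))).
by rewrite -{1}(SE c a) -rE gmulfM -mulgA -rE.
Qed.

(** Given equivariant retractions [r] and [s] onto [C], the involution of [A * B]
   that exchanges the [C]-components of the two coordinates: it carries the action
   of [C] on the first coordinate to its action on the second one. *)
Section Swap.
Variables (A B C : groupType).
Variables (f : {multiplicative C -> A}) (g : {multiplicative C -> B}).
Variables (r : A -> C) (s : B -> C).
Hypothesis rE : forall c a, r (f c * a) = c * r a.
Hypothesis sE : forall c b, s (g c * b) = c * s b.

Definition swap (x : A * B) : A * B :=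
  (f (s x.2 * (r x.1)^-1) * x.1, g (r x.1 * (s x.2)^-1) * x.2).

Lemma swapK : involutive swap.
Proof.
case=> a b; rewrite /swap /= rE sE !mulgVK.
by congr pair; rewrite mulgA -gmulfM mulgA mulgVK mulgV mult1 mul1g.
Qed.

Lemma swap_equivariant c a b :
  swap (f c * a, b) = ((swap (a, b)).1, g c * (swap (a, b)).2).
Proof.
rewrite /swap; apply: (congr2 pair) => /=; rewrite rE.
  by rewrite mulgA -gmulfM invgM mulgA mulgVK.
rewrite -(mulgA c) (_ : g (c * _) = g c * g (r a * (s b)^-1)) -?mulgA //.
exact: gmulfM.
Qed.
End Swap.

Definition pair_swap (A B : Type) (x : A * B) : B * A := (x.2, x.1).

Lemma pair_swapK (A B : Type) : cancel (@pair_swap A B) (@pair_swap B A).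
Proof. by case. Qed.

(** Both [A] and [B] act freely on [A * B], [A] on the first coordinate and [B] on
   the second one up to the involution [swap], so that the actions of [C] agree. *)
Lemma amalgam_injective (A B C G : groupType)
    (f : {multiplicative C -> A}) (g : {multiplicative C -> B})
    (i : {multiplicative A -> G}) (j : {multiplicative B -> G}) :
  is_amalgamated_product f g i j -> injective i /\ injective j.
Proof.
move=> [injf injg _ univ].
have [r rE] := equivariant_retraction injf; have [s sE] := equivariant_retraction injg.
pose h := @pair_swap A B \o swap f g r s; pose h' := swap f g r s \o @pair_swap B A.
have hK : cancel h h' by move=> x; rewrite /h /h' /= pair_swapK swapK.
have h'K : cancel h' h by move=> x; rewrite /h /h' /= swapK // pair_swapK.
pose p := action_bij (mul_action A B).
pose q := action_bij (transport_action (mul_action B A) hK h'K).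
have [|u [ui uj _]] := univ (selfbij (A * B)) p q.
  move=> c; apply: selfbij_eq => x.
  rewrite /p /q /action_bij /bij_fun /= /conj_fun /mulact /=.
  apply: (can_inj hK); rewrite h'K.
  by case: x => a b; rewrite /h /= swap_equivariant.
split=> [a a' ia|b b' jb].
  have := congr1 (fun z => (bij_fun z (1, 1)).1) (congr1 u ia).
  by rewrite !ui /bij_fun /= !mulg1.
have qE d : bij_fun (q d) (h' (1, 1)) = h' (mulact d (h (h' (1, 1)))) by [].
have := congr1 (fun z => (h (bij_fun z (h' (1, 1)))).1) (congr1 u jb).
by rewrite !uj !qE !h'K /= !mulg1.
Qed.

(** The base group [K] acts freely on [K * K], on the first coordinate.  The
   bijection [h], which is [swap] followed by the exchange of the coordinates,
   conjugates the action of [alpha x] to that of [x]. *)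
Lemma HNN_injective (K : groupType) (A : subgroup K)
    (alpha : {multiplicative subgroup_type A -> K})
    (G : groupType) (k : {multiplicative K -> G}) (t : G) :
  is_HNN_extension alpha k t -> injective k.
Proof.
move=> [inja _ univ].
pose iota : {multiplicative subgroup_type A -> K} := val.
have [r rE] := equivariant_retraction inja.
have [s sE] := equivariant_retraction (val_inj : injective iota).
pose h := @pair_swap K K \o swap alpha iota r s.
pose h' := swap alpha iota r s \o @pair_swap K K.
have hK : cancel h h' by move=> x; rewrite /h /h' /= pair_swapK swapK.
have h'K : cancel h' h by move=> x; rewrite /h /h' /= swapK // pair_swapK.
pose p := action_bij (mul_action K K).
have [|u [uk _ _]] := univ (selfbij (K * K)) p (mkbij hK h'K).
  move=> x; rewrite conjgE; apply: (mulgI (mkbij hK h'K)); rewrite mulVKg.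
  apply: selfbij_eq => -[a b]; rewrite !bij_funM /bij_fun /= /mulact /h /=.
  by rewrite swap_equivariant.
move=> a a' ka.
have := congr1 (fun z => (bij_fun z (1, 1)).1) (congr1 u ka).
by rewrite !uk /bij_fun /= !mulg1.
Qed.

(** * Cocycles *)

(** The semidirect product of the group of functions from [S] to the booleans,
   under pointwise exclusive or, by a group [G] acting on [S]. *)
Definition semidirect (G : groupType) (S : Type) (b : group_action G S) : Type :=
  ((S -> bool) * G)%type.

Section Semidirect.
Variables (G : groupType) (S : Type) (b : group_action G S).
Local Notation L := (semidirect b).

HB.instance Definition _ := gen_eqMixin L.
HB.instance Definition _ := gen_choiceMixin L.

Definition semi_one : L := (fun=> false, 1).
Definition semi_V (x : L) : L := (fun e => x.1 (b x.2 e), x.2^-1).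
Definition semi_mul (x y : L) : L := (fun e => x.1 e (+) y.1 (b x.2^-1 e), x.2 * y.2).

Lemma semi_eq (x y : L) : x.1 =1 y.1 -> x.2 = y.2 -> x = y.
Proof. by case: x y => [u g] [v h] /= /funext -> ->. Qed.

Fact semi_mulA : associative semi_mul.
Proof.
move=> x y z; apply: semi_eq => [e|] /=; last exact: mulgA.
by rewrite invgM actM addbA.
Qed.
Fact semi_mul1 : left_id semi_one semi_mul.
Proof. by move=> x; apply: semi_eq => [e|] /=; rewrite ?invg1 ?act1 ?mul1g. Qed.
Fact semi_1mul : right_id semi_one semi_mul.
Proof. by move=> x; apply: semi_eq => [e|] /=; rewrite ?addbF ?mulg1. Qed.
Fact semi_mulV : left_inverse semi_one semi_V semi_mul.
Proof. by move=> x; apply: semi_eq => [e|] /=; rewrite ?invgK ?addbb ?mulVg. Qed.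
Fact semi_Vmul : right_inverse semi_one semi_V semi_mul.
Proof.
by move=> x; apply: semi_eq => [e|] /=; rewrite ?mulgV // actVK addbb.
Qed.

HB.instance Definition _ :=
  isGroup.Build L semi_mulA semi_mul1 semi_1mul semi_mulV semi_Vmul.

Definition semi_proj (x : L) : G := x.2.
Fact semi_proj_mult : {morph semi_proj : x y / x * y}.
Proof. by []. Qed.
HB.instance Definition _ := isMultiplicative.Build L G semi_proj semi_proj_mult.

Lemma semi_mul1E (x y : L) e : (x * y).1 e = x.1 e (+) y.1 (b (semi_proj x)^-1 e).
Proof. by []. Qed.

(** The coboundary of a function [u]. *)
Definition coboundary (u : S -> bool) (g : G) : L :=
  (fun e => u (b g^-1 e) (+) u e, g).
Fact coboundary_mult u : {morph coboundary u : g h / g * h}.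
Proof.
move=> g h; apply: semi_eq => [e|//] /=.
by rewrite invgM actM; case: (u e); case: (u (b g^-1 e)); case: (u _).
Qed.
HB.instance Definition _ u :=
  isMultiplicative.Build G L (coboundary u) (coboundary_mult u).

End Semidirect.

(** * Amalgamated products and HNN-extensions *)

Section Amalgam.
Variables (A B C G : groupType).
Variables (f : {multiplicative C -> A}) (g : {multiplicative C -> B}).
Variables (i : {multiplicative A -> G}) (j : {multiplicative B -> G}).
Hypothesis amalgam : is_amalgamated_product f g i j.

Lemma amalgam_uniq (L : groupType) (u v : {multiplicative G -> L}) :
  (forall a, u (i a) = v (i a)) -> (forall b, u (j b) = v (j b)) -> u =1 v.
Proof.
move=> ui uj x.
have [|w [_ _ wP]] := amalgam_univ amalgam (p := v \o i) (q := v \o j).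
  by move=> c /=; rewrite (amalgam_comm amalgam).
by rewrite (wP u) // (wP v).
Qed.

Lemma amalgam_generated (S : subgroup G) :
  (forall a, subgroup_set S (i a)) -> (forall b, subgroup_set S (j b)) ->
  forall x, subgroup_set S x.
Proof.
move=> Si Sj x.
have [|u [ui uj _]] := amalgam_univ amalgam (p := corestrict Si) (q := corestrict Sj).
  by move=> c; apply: val_inj; rewrite /= (amalgam_comm amalgam).
have -> : x = ((val : subgroup_type S -> G) \o u) x.
  by apply: (amalgam_uniq (u := idfun)) => [a|b] /=; rewrite ?ui ?uj.
exact: set_mem (valP (u x)).
Qed.

(** The edges are the cosets of the image of [C]; the coset of [1] joins the cosets
   of [1] for [i A] and for [j B]. *)
Lemma amalgam_HFF (R : realType) : HFF R A -> HFF R B -> HFF R G.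
Proof.
move=> HA HB; have [inji injj] := amalgam_injective amalgam.
pose imA := image_subgroup i (full_subgroup A).
pose imB := image_subgroup j (full_subgroup B).
pose imC := image_subgroup (i \o f) (full_subgroup C).
pose KV (v : bool) := if v then imB else imA.
pose KE (_ : unit) := imC.
pose src (_ : unit) := false; pose tgt (_ : unit) := true; pose x (_ : unit) : G := 1.
have KEs n h : subgroup_set (KE n) h -> subgroup_set (KV (src n)) h.
  by move=> [c _ <-]; exists (f c).
have KEt n h : subgroup_set (KE n) h -> subgroup_set (KV (tgt n)) (h ^ x n).
  by move=> [c _ <-]; exists (g c) => //=; rewrite conjg1 (amalgam_comm amalgam).
pose e0 := mkcoset KE tt 1; pose b := coset_action KE.
pose delta e := `[< e = e0 >].
have deltaE y e : delta (b y^-1 e) = `[< e = mkcoset KE tt y >].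
  exact: coset_act_base.
have deltaC c e : delta (b (j (g c))^-1 e) = delta e.
  rewrite deltaE /delta (_ : mkcoset _ _ _ = e0) //; apply/esym/mkcoset_eq.
  by exists c => //=; rewrite invg1 mul1g (amalgam_comm amalgam).
(* the cocycle [D] that vanishes on [A] and that is the coboundary of [delta] on
   [B]: these agree on [C], which fixes [e0] *)
pose p : {multiplicative A -> semidirect b} := coboundary b (fun=> false) \o i.
pose q : {multiplicative B -> semidirect b} := coboundary b delta \o j.
have [|D [Di Dj _]] := amalgam_univ amalgam (p := p) (q := q).
  move=> c; apply: semi_eq => [e|] /=; last exact: amalgam_comm.
  by rewrite deltaC addbb.
have D2 y : semi_proj (D y) = y.
  apply: (amalgam_uniq (u := @semi_proj _ _ b \o D) (v := idfun)) => [a|d] /=.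
    by rewrite Di.
  by rewrite Dj.
have qE d e : (q d).1 e = delta (b (j d)^-1 e) (+) delta e by [].
(* the coset of [y] for [B] is across the edge of [y] from the one for [A] *)
pose phi (v : bool) y e := (D y).1 e (+) (v && delta (b y^-1 e)).
have phi_coset v y k e : subgroup_set (KV v) k -> phi v (y * k) e = phi v y e.
  rewrite /phi gmulfM semi_mul1E D2; case: v => -[d _ <-].
    rewrite !andTb Dj qE invgM actM.
    by case: (delta _); case: (delta _); case: (_.1 e).
  by rewrite Di /= !addbF.
have phi_edge n y e :
    phi (tgt n) (y * x n) e = phi (src n) y e (+) `[< e = mkcoset KE n y >].
  by rewrite mulg1 /phi /= addbF deltaE; case: n.
apply: (coset_tree_HFF KEs KEt (phi := phi) _ phi_coset phi_edge false).
  pose lk := @linked _ _ _ KV KE src tgt x.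
  have lk_edge y : lk (mkcoset KV false y) (mkcoset KV true y).
    by have := linked_edge KEs KEt tt y; rewrite mulg1.
  have lk0 y : lk (mkcoset KV false 1) (mkcoset KV false y).
    apply: (amalgam_generated (S := linked_subgroup KEs KEt false)) => [a|d] /=.
      rewrite -(mkcoset_eq (g := 1)); first exact: linked_refl.
      by exists a => //; rewrite invg1 mul1g.
    apply: linked_trans (lk_edge 1) _.
    rewrite (mkcoset_eq (h := j d)); first exact/linked_sym/lk_edge.
    by exists d => //; rewrite invg1 mul1g.
  have lkv v : lk (mkcoset KV false 1) v.
    elim/coset_ind: v => -[] y; last exact: lk0.
    exact: linked_trans (lk0 y) (lk_edge y).
  by move=> v w; exact: linked_trans (linked_sym (lkv v)) (lkv w).
by case; exact: HFF_image.
Qed.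

End Amalgam.

Section HNN.
Variables (K : groupType) (A : subgroup K).
Variables (alpha : {multiplicative subgroup_type A -> K}).
Variables (G : groupType) (k : {multiplicative K -> G}) (t : G).
Hypothesis hnn : is_HNN_extension alpha k t.

Lemma HNN_uniq (L : groupType) (u v : {multiplicative G -> L}) :
  (forall a, u (k a) = v (k a)) -> u t = v t -> u =1 v.
Proof.
move=> uk ut x.
have [|w [_ _ wP]] := HNN_univ hnn (p := v \o k) (s := v t).
  move=> y /=; rewrite -(HNN_rel hnn) !conjgE !gmulfM multV //.
by rewrite (wP u) // (wP v).
Qed.

Lemma HNN_generated (S : subgroup G) :
  (forall a, subgroup_set S (k a)) -> subgroup_set S t -> forall x, subgroup_set S x.
Proof.
move=> Sk St x; pose s : subgroup_type S := exist _ t (mem_set St).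
have [|u [uk ut _]] := HNN_univ hnn (p := corestrict Sk) (s := s).
  move=> y; rewrite conjgE; apply: (mulgI s); rewrite mulVKg; apply: val_inj.
  by rewrite !valM /= -(HNN_rel hnn) conjgE mulVKg.
have -> : x = ((val : subgroup_type S -> G) \o u) x.
  by apply: (HNN_uniq (u := idfun)) => [a|] /=; rewrite ?uk ?ut.
exact: set_mem (valP (u x)).
Qed.

(** The vertices are the cosets of [k K], the edges those of [k A]; the edge of [y]
   goes from the coset of [y] to the coset of [y * t]. *)
Lemma HNN_HFF (R : realType) : HFF R K -> HFF R G.
Proof.
move=> HK; have injk := HNN_injective hnn.
pose KV (_ : unit) := image_subgroup k (full_subgroup K).
pose KE (_ : unit) := image_subgroup k A.
pose x (_ : unit) := t.
have KEs n h : subgroup_set (KE n) h -> subgroup_set (KV (id n)) h.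
  by move=> [a _ <-]; exists a.
have KEt n h : subgroup_set (KE n) h -> subgroup_set (KV (id n)) (h ^ x n).
  move=> [a Aa <-]; pose a' : subgroup_type A := exist _ a (mem_set Aa).
  by exists (alpha a') => //; rewrite -(HNN_rel hnn).
pose e0 := mkcoset KE tt 1; pose b := coset_action KE.
pose delta e := `[< e = e0 >].
have deltaE y e : delta (b y^-1 e) = `[< e = mkcoset KE tt y >].
  exact: coset_act_base.
(* the cocycle [D] that vanishes on [K] and takes the value [delta] at [t] *)
pose p : {multiplicative K -> semidirect b} := coboundary b (fun=> false) \o k.
have [|D [Dk Dt _]] := HNN_univ hnn (p := p) (s := (delta, t) : semidirect b).
  move=> y; rewrite conjgE; apply: (mulgI ((delta, t) : semidirect b)).
  rewrite mulVKg; apply: semi_eq => [e|] /=.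
    rewrite addbF deltaE (_ : mkcoset _ _ _ = e0) //; apply/esym/mkcoset_eq.
    by rewrite invg1 mul1g; exists (val y) => //; exact: set_mem (valP y).
  by rewrite -(HNN_rel hnn) conjgE mulVKg.
have D2 y : semi_proj (D y) = y.
  apply: (HNN_uniq (u := @semi_proj _ _ b \o D) (v := idfun)) => [a|] /=.
    by rewrite Dk.
  by rewrite Dt.
pose phi (_ : unit) y e := (D y).1 e.
have phi_coset v y h e : subgroup_set (KV v) h -> phi v (y * h) e = phi v y e.
  by move=> [a _ <-]; rewrite /phi gmulfM semi_mul1E Dk /= addbF.
have phi_edge n y e :
    phi (id n) (y * x n) e = phi (id n) y e (+) `[< e = mkcoset KE n y >].
  by rewrite /phi gmulfM semi_mul1E D2 Dt /= deltaE; case: n.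
apply: (coset_tree_HFF KEs KEt (phi := phi) _ phi_coset phi_edge tt).
  have lk0 y : linked KE id id x (mkcoset KV tt 1) (mkcoset KV tt y).
    apply: (HNN_generated (S := linked_subgroup KEs KEt tt)) => [a|] /=.
      rewrite -(mkcoset_eq (g := 1)); first exact: linked_refl.
      by exists a => //; rewrite invg1 mul1g.
    by have := linked_edge KEs KEt tt 1; rewrite mul1g.
  have lkv v : linked KE id id x (mkcoset KV tt 1) v.
    by elim/coset_ind: v => n y; case: n; exact: lk0.
  by move=> v w; exact: linked_trans (linked_sym (lkv v)) (lkv w).
by move=> n; exact: HFF_image.
Qed.

End HNN.

Theorem proposition5p5 (R : realType) :
  closed_under_countable_directed_unions (HFF R) /\
  closed_under_amalgamated_products (HFF R) /\
  closed_under_HNN_extensions (HFF R).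
Proof.
split; first exact: countable_directed_union_HFF.
split; first by move=> A B C G f g i j /amalgam_HFF; apply.
by move=> K A alpha G k t /HNN_HFF; apply.
Qed.
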